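(* Let $\gamma$ be a singular graphon. For any $s\ge 2$ and any finite graphs $F_1,\ldots,F_s$, $$\kappa_s(F_1,\ldots,F_s)(\gamma)=0.$$
   Context: Graphs are finite, simple and undirected, with at least one vertex. A graph function is a measurable symmetric $g:[0,1]^2\to[0,1]$ (up to null sets); a graphon $\gamma=[g]$ is an equivalence class of graph functions for the relation $\delta_\square=0$, where $\delta_\square$ is the cut-metric $\inf_\sigma \sup_{S,T}|\int_{S\times T}(g_1(\sigma(x),\sigma(y))-g_2(x,y))\,dx\,dy|$, $\sigma$ running over measure-preserving measurable bijections of $[0,1]$ and $S,T$ over measurable subsets. For a graph $F$ on $\{1,\dots,k\}$, $t(F,\gamma)=\int_{[0,1]^k}\prod_{\{i,j\}\in E_F}g(x_i,x_j)\,dx_1\cdots dx_k$. For graphs $F_1,F_2$ on $k_1,k_2$ vertices, $F_1F_2$ is their disjoint union and $(F_1\bowtie F_2)(i_1,i_2)$ is the graph obtained from it by identifying vertex $i_1$ of $F_1$ with vertex $i_2$ of $F_2$. The graphon $\gamma$ is singular if for all finite graphs $F_1,F_2$, $t(F_1F_2,\gamma)=\frac1{k_1k_2}\sum_{i_1=1}^{k_1}\sum_{i_2=1}^{k_2}t((F_1\bowtie F_2)(i_1,i_2),\gamma)$. Hypertrees. A hypergraph on a finite set $W$ is a finite collection $E$ (repetitions allowed) of hyperedges, each a multiset $e$ of elements of $W$ with $d\ge2$ elements counted with multiplicity; $\deg e=d-1$. It is connected if any two distinct vertices $v,w$ are linked by hyperedges $e_1,\dots,e_r$ with $v\in e_1$,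 $w\in e_r$ and $e_i\cap e_{i+1}\neq\emptyset$. It is a hypertree if it is connected and $\sum_{e\in E}\deg e=|W|-1$. Denote by $\mathbf{LH}(s)$ the set of hypertrees on $\{1,\dots,s\}$. Let $F_1,\dots,F_s$ have $k_1,\dots,k_s$ vertices and let $V=\bigsqcup_{r=1}^sV_{F_r}=\{(r,a): 1\le r\le s,\ 1\le a\le k_r\}$. A set partition $\pi$ of $V$ gives a hypergraph $H_\pi$ on $\{1,\dots,s\}$: each part $\{(r_1,a_1),\dots,(r_m,a_m)\}$ with $m\ge2$ gives the hyperedge (multiset) $\{r_1,\dots,r_m\}$. For a graph $F$ and a set partition $\rho$ of $V_F$, the contracted graph $F\downarrow\rho$ has the parts of $\rho$ as vertices, with one edge between two parts if some edge of $F$ joins an element of one to an element of the other. For $\theta$ a set partition of $\{1,\dots,s\}$ with parts $\theta_1,\dots,\theta_{\ell(\theta)}$, set $\mu(\theta)=(-1)^{\ell(\theta)-1}(\ell(\theta)-1)!$, $\Theta_j=\bigsqcup_{r\in\theta_j}V_{F_r}$, and let $\Theta_j\wedge\pi$ be the set partition of $\Theta_j$ induced by $\pi$. For $\pi$ such that $H_\pi$ is a hypertree, set $$\kappa_\pi(F_1,\dots,F_s)(\gamma)=\sum_{\theta}\mu(\theta)\prod_{j=1}^{\ell(\theta)}t\Big(\Big(\bigsqcup_{r\in\theta_j}F_r\Big)\downarrow(\Theta_j\wedge\pi),\gamma\Big),$$ the sum being over all set partitions $\theta$ of $\{1,\dots,s\}$ (these contracted graphs are loopless). Finally $$\kappa_s(F_1,\dots,F_s)(\gamma)=\sum_{H\in\mathbf{LH}(s)}\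 \sum_{\pi\,:\,H_\pi=H}\kappa_\pi(F_1,\dots,F_s)(\gamma).$$ *)

(* Defs.v *)
From HB Require Import structures.
From mathcomp Require Import all_boot all_order all_algebra.
From mathcomp Require Import finmap multiset.
From mathcomp Require Import all_classical all_reals all_analysis.
Set Implicit Arguments.
Unset Strict Implicit.
Unset Printing Implicit Defensive.
Import Order.TTheory GRing.Theory Num.Theory.
Local Open Scope classical_set_scope.
Local Open Scope ring_scope.

(* The vertex set may be empty here; nonemptiness is required explicitly where
   graphs are quantified over. *)
Record sgraph := SGraph {
  vertex :> finType;
  adj : rel vertex;
  adj_sym : symmetric adj;
  adj_irr : irreflexive adj }.

Section Contraction.
Variables (G : sgraph) (rho : {set {set G}}).

(* An edge inside a part would become a loop and is discarded; this never occurs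
   for the partitions summed over below, whose hypergraph is a hypertree. *)
Definition contract_adj : rel {B : {set G} | B \in rho} := fun B C =>
  (B != C) && [exists x in val B, [exists y in val C, adj x y]].

Lemma contract_sym : symmetric contract_adj.
Proof.
move=> B C; rewrite /contract_adj eq_sym; congr (_ && _).
by apply/existsP/existsP => -[x /andP[xB /existsP[y /andP[yC xy]]]];
  exists y; rewrite yC; apply/existsP; exists x; rewrite xB adj_sym.
Qed.

Lemma contract_irr : irreflexive contract_adj.
Proof. by move=> B; rewrite /contract_adj eqxx. Qed.

Definition contract : sgraph := SGraph contract_sym contract_irr.
End Contraction.

Section DisjointUnion2.
Variables F1 F2 : sgraph.

Definition dunion2_adj : rel (F1 + F2)%type := fun u v =>
  match u, v with
  | inl a, inl b => adj a b
  | inr a, inr b => adj a b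
  | _, _ => false
  end.

Lemma dunion2_sym : symmetric dunion2_adj.
Proof. by move=> [a|a] [b|b] //=; rewrite adj_sym. Qed.

Lemma dunion2_irr : irreflexive dunion2_adj.
Proof. by move=> [a|a] /=; rewrite adj_irr. Qed.

Definition dunion2 : sgraph := SGraph dunion2_sym dunion2_irr.

Definition glue (i1 : F1) (i2 : F2) : {set {set dunion2}} :=
  let P : {set dunion2} := [set inl i1; inr i2]%SET in
  (P |: [set [set x]%SET | x in (~: P)%SET])%SET.

Definition bowtie (i1 : F1) (i2 : F2) : sgraph := contract (glue i1 i2).
End DisjointUnion2.

Section DisjointUnion.
Variables (I : finType) (F : I -> sgraph).

Definition dunion_adj : rel {r : I & F r} := fun u v =>
  (tag u == tag v) && adj (tagged u) (tagged_as u v).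

Lemma dunion_sym : symmetric dunion_adj.
Proof.
have half u v : dunion_adj u v -> dunion_adj v u.
  case: u v => [r a] [r' b] /andP[/= /eqP rr'].
  subst r'; rewrite (@tagged_asE _ _ (Tagged (fun r => vertex (F r)) a) b) => ab.
  apply/andP; split=> //=.
  by rewrite (@tagged_asE _ _ (Tagged (fun r => vertex (F r)) b) a) adj_sym.
by move=> u v; apply/idP/idP; exact: half.
Qed.

Lemma dunion_irr : irreflexive dunion_adj.
Proof.
case=> r a; rewrite /dunion_adj.
by rewrite (@tagged_asE _ _ (Tagged (fun r => vertex (F r)) a) a) adj_irr andbF.
Qed.

Definition dunion : sgraph := SGraph dunion_sym dunion_irr.
End DisjointUnion.

Section Graphons.
Variable R : realType.

(* R with its Borel sets, on which [lebesgue_measure] is declared. *)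
Local Notation TR := (measurableTypeR R).

Definition unit_itv : set TR := `[0, 1].

(* Only the values on the unit square matter. *)
Record graph_function := GraphFunction {
  gfun :> TR * TR -> R;
  gfun_meas : measurable_fun (unit_itv `*` unit_itv) gfun;
  gfun_sym : forall x y, unit_itv x -> unit_itv y -> gfun (x, y) = gfun (y, x);
  gfun_01 : forall x y, unit_itv x -> unit_itv y -> 0 <= gfun (x, y) <= 1 }.

Definition mp_bijection (sigma : TR -> TR) : Prop :=
  [/\ set_bij unit_itv unit_itv sigma,
      measurable_fun unit_itv sigma &
      forall A : set TR, measurable A -> A `<=` unit_itv ->
        lebesgue_measure (unit_itv `&` sigma @^-1` A) = lebesgue_measure A].

Definition cut_discrepancy (g1 g2 : graph_function) (sigma : TR -> TR) : R :=
  sup [set d | exists S T : set TR,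
    [/\ measurable S, S `<=` unit_itv, measurable T, T `<=` unit_itv &
        d = `| \int[(lebesgue_measure \x lebesgue_measure)%E]_(p in S `*` T)
                 (g1 (sigma p.1, sigma p.2) - g2 p) |]].

Definition cut_distance (g1 g2 : graph_function) : R :=
  inf [set cut_discrepancy g1 g2 sigma | sigma in mp_bijection].

Definition graphon_class (g : graph_function) : set graph_function :=
  [set h | cut_distance g h = 0].

Record graphon := Graphon {
  graphon_set :> set graph_function;
  graphonP : exists g, graphon_set = graphon_class g }.

Definition graphon_repr (gamma : graphon) : graph_function :=
  projT1 (cid (graphonP gamma)).

Definition lebesgue01 : set TR -> \bar R :=
  mrestr (@lebesgue_measure R) (measurable_itv `[0, 1] : measurable unit_itv).

HB.instance Definition _ := Measure.on lebesgue01.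

Lemma lebesgue01_setT : lebesgue01 setT = 1%E.
Proof.
by rewrite /lebesgue01 /mrestr setTI lebesgue_measure_itv /= lte_fin ltr01 oppr0 adde0.
Qed.

HB.instance Definition _ :=
  Measure_isProbability.Build _ _ R lebesgue01 lebesgue01_setT.

Definition cons_tuple k (p : TR * k.-tuple TR) : k.+1.-tuple TR :=
  [tuple of p.1 :: p.2].

Lemma measurable_cons_tuple k : measurable_fun setT (@cons_tuple k).
Proof. exact: measurable_cons. Qed.

HB.instance Definition _ k :=
  isMeasurableFun.Build _ _ _ _ (@cons_tuple k) (@measurable_cons_tuple k).

(* The k-fold product of Lebesgue measure on [0, 1]. *)
Fixpoint cube_measure k : probability (k.-tuple TR) R :=
  match k with
  | 0 => \d_ [tuple]
  | k'.+1 => distribution (lebesgue01 \x cube_measure k')%E (@cons_tuple k')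
  end.

Definition cube k : set (k.-tuple TR) :=
  [set x | forall i, unit_itv (tnth x i)].

(* The side condition on ranks selects one orientation of each edge. *)
Definition hom_density_fun (F : sgraph) (g : graph_function) : R :=
  \int[cube_measure #|F|]_(x in @cube #|F|)
    \prod_(p : F * F | adj p.1 p.2 && (enum_rank p.1 < enum_rank p.2)%N)
      g (tnth x (enum_rank p.1), tnth x (enum_rank p.2)).

(* The value does not depend on the representative, since homomorphism
   densities are continuous for the cut distance. *)
Definition hom_density (F : sgraph) (gamma : graphon) : R :=
  hom_density_fun F (graphon_repr gamma).

Definition singular (gamma : graphon) : Prop :=
  forall F1 F2 : sgraph, (0 < #|F1|)%N -> (0 < #|F2|)%N ->
    hom_density (dunion2 F1 F2) gamma =
    (#|F1| * #|F2|)%:R^-1 *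
      \sum_(i1 : F1) \sum_(i2 : F2) hom_density (bowtie i1 i2) gamma.
End Graphons.

Notation hypergraph W := {mset {mset W}}%mset.

Section Hypertrees.
Local Open Scope mset_scope.
Variable W : finType.

Definition is_hypergraph (E : hypergraph W) : Prop :=
  forall e : {mset W}, e \in E -> (2 <= size e)%N.

Definition hyperedge_deg (e : {mset W}) : nat := (size e - 1)%N.

Definition meets (e f : {mset W}) : bool := [exists z, (z \in e) && (z \in f)].

Definition hconnected (E : hypergraph W) : Prop :=
  forall v w : W, v != w ->
    exists (e : {mset W}) (p : seq {mset W}),
      [/\ all [in E] (e :: p), path meets e p, v \in e & w \in last e p].

Definition hypertree (E : hypergraph W) : Prop :=
  [/\ is_hypergraph E, hconnected E &
      (\sum_(e <- E) hyperedge_deg e = #|W| - 1)%N].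
End Hypertrees.

Definition LH (s : nat) : set (hypergraph 'I_s) := [set H | hypertree H].
Arguments LH : clear implicits.

Definition mobius_coef (R : realType) (s : nat) (theta : {set {set 'I_s}}) : R :=
  (-1) ^+ (#|theta| - 1) * ((#|theta| - 1)`!)%:R.

Section Cumulants.
Variables (R : realType) (s : nat) (F : 'I_s -> sgraph).

(* Parts of [pi] with at least two elements, seen as multisets of indices. *)
Definition hypergraph_of (pi : {set {set dunion F}}) : hypergraph 'I_s :=
  seq_mset [seq seq_mset [seq tag x | x <- enum B]
           | B : {set dunion F} <- enum pi & (2 <= #|B|)%N].

Section Block.
Variable B : {set 'I_s}.

Definition block_union : sgraph :=
  dunion (fun r : {r : 'I_s | r \in B} => F (val r)).

Definition block_incl (x : block_union) : dunion F :=
  Tagged (fun r => vertex (F r)) (tagged x).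

(* The partition of the vertices of [block_union] induced by [pi]. *)
Definition block_trace (pi : {set {set dunion F}}) : {set {set block_union}} :=
  ([set block_incl @^-1: P | P : {set dunion F} in pi] :\ finset.set0)%SET.
End Block.

Definition kappa_pi (pi : {set {set dunion F}}) (gamma : graphon R) : R :=
  \sum_(theta : {set {set 'I_s}} | finset.partition theta [set: 'I_s]%SET)
    mobius_coef R theta *
    \prod_(B in theta) hom_density (contract (block_trace B pi)) gamma.

(* The outer sum is a finitely supported sum over [LH s]: only finitely many
   hypergraphs are of the form [hypergraph_of pi]. *)
Definition kappa (gamma : graphon R) : R :=
  \sum_(H \in LH s)
    \sum_(pi : {set {set dunion F}} |
            finset.partition pi [set: dunion F]%SET && (hypergraph_of pi == H))
      kappa_pi pi gamma.
End Cumulants.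

(* Main.v *)
Require Import Defs.
From HB Require Import structures.
From mathcomp Require Import all_boot all_order all_algebra.
From mathcomp Require Import fingroup perm.
From mathcomp Require Import finmap multiset.
From mathcomp Require Import all_classical all_reals all_analysis.
From mathcomp Require Import measurable_realfun.
From mathcomp Require Import ring zify.
Set Implicit Arguments.
Unset Strict Implicit.
Unset Printing Implicit Defensive.
Import Order.TTheory GRing.Theory Num.Theory.
Local Open Scope classical_set_scope.
Local Open Scope ring_scope.

(** A graph [F] and one of its vertices [a] define a rooted density: the
    homomorphism density of [F] conditional on the image of [a].  Gluing two
    graphs at a vertex multiplies rooted densities and integrates
    ([mean_bowtie]).  Applied to two copies of [F], singularity therefore says
    that the sum of the rooted densities over all the roots [a] has variance 0:
    it is almost everywhere equal to [#|F|] times the density of [F].  It is used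
    in the form [singular_sum_rooted]: in any integral, the sum may be replaced
    by this constant.

    A hypertree with at least two vertices has a leaf [r], a vertex of total
    degree at most 1 ([hypertree_leaf]).  For a partition with this hypergraph,
    the graph [F r] then meets the other graphs in one vertex only.  Permuting
    the vertices of [F r] permutes the partitions with the given hypergraph
    ([sum_relabel]), so the sum over these partitions may be averaged over such
    permutations.  For fixed [theta], averaging turns the rooted density of [F r]
    into the constant above, so that the density of [F r] splits off as a factor
    ([sum_hom_density_relabel]).  It splits off in the same way whichever block
    of [theta] contains [r]; what remains depends on [theta] only through its
    blocks with [r] removed.  The sum over [theta] then vanishes, since the
    Moebius coefficients of all the ways to insert [r] into a given partition
    of the other indices cancel ([moebius_sum_eq0]).  Hence already the sum over
    the partitions with one given hypergraph is 0.

    Two points need care.  Contraction keeps at most one edge between two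
    parts, so the densities are integrals of products over the edges of the
    original graphs only if no edges are merged; this follows from the
    hypertree condition through [hypertree_cut].  Also, all integrals are taken
    over points indexed by a finite type of variable names ([mean]); renaming
    variables, discarding unused ones and integrating in steps are instances of
    one change of variables ([mean_merge]). *)

(** * Moebius sums over set partitions *)

Section Moebius.
Local Open Scope set_scope.
Variables (R : comPzRingType) (T : finType) (r : T).
Implicit Types (theta sigma : {set {set T}}) (B C : {set T}).

Let mu theta : R := (-1) ^+ (#|theta| - 1) * ((#|theta| - 1)`!)%:R.

Let insert sigma C : {set {set T}} := (r |: C) |: (sigma :\ C).
Let single sigma : {set {set T}} := [set r] |: sigma.

Section Extend.
Variables (sigma : {set {set T}}) (sigP : finset.partition sigma [set~ r]).

Lemma notin_block C : C \in sigma -> r \notin C.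
Proof.
move/(partitionS sigP)/fintype.subsetP => sub.
by apply/negP => /sub; rewrite !inE eqxx.
Qed.

Let setrT : [set r] :|: [set~ r] = [set: T].
Proof. by apply/setP => x; rewrite !inE orbN. Qed.

Lemma single_notin : [set r] \notin sigma.
Proof. by apply/negP => /notin_block; rewrite set11. Qed.

Lemma partition_single : finset.partition (single sigma) [set: T].
Proof.
rewrite -setrT; apply: partitionU1 => //.
  by apply/set0Pn; exists r; exact: set11.
by rewrite disjoints1 !inE eqxx.
Qed.

Variables (C : {set T}) (Csig : C \in sigma).

Lemma insert_notin : r |: C \notin sigma :\ C.
Proof.
rewrite !inE negb_and; apply/orP; right.
by apply/negP => /notin_block; rewrite setU11.
Qed.

Lemma partition_insert : finset.partition (insert sigma C) [set: T].
Proof.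
have -> : [set: T] = (r |: C) :|: ([set~ r] :\: C).
  by apply/setP => x; rewrite !inE; case: (x == r) => //=; case: (x \in C).
apply: partitionU1; first exact: partitionD1.
  by apply/set0Pn; exists r; rewrite setU11.
rewrite -setI_eq0; apply/eqP/setP => x; rewrite !inE.
by case: (x == r) => //=; case: (x \in C).
Qed.

Lemma pblock_insert : finset.pblock (insert sigma C) r = r |: C.
Proof.
by apply: def_pblock (partition_trivIset partition_insert) _ _; rewrite setU11.
Qed.

Lemma single_notin_insert : [set r] \notin insert sigma C.
Proof.
apply/negP; rewrite in_setU1 => /orP[/eqP rC|]; last first.
  by rewrite !inE (negPf single_notin) andbF.
have /set0Pn[x xC] := partition_neq0 sigP Csig.
have : x \in r |: C by rewrite setU1r.
by rewrite -rC inE => /eqP xr; move: (notin_block Csig); rewrite -xr xC.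
Qed.

Lemma insertK : (r |: C) :\ r = C.
Proof. by apply: finset.setU1K; exact: notin_block. Qed.

End Extend.

(** A partition of [T] restricts to a partition [sigma] of the complement of [r],
and it is recovered from [sigma] by saying which block receives [r], or that
none does. *)
Lemma sum_partition_insert (f : {set {set T}} -> R) :
  \sum_(theta | finset.partition theta [set: T]) f theta =
  \sum_(sigma | finset.partition sigma [set~ r])
     (f (single sigma) + \sum_(C in sigma) f (insert sigma C)).
Proof.
rewrite big_split /= (bigID (fun theta => [set r] \in theta)) /=; congr (_ + _).
  rewrite (reindex_onto single (fun theta => theta :\ [set r])) /=; last first.
    by move=> theta /andP[_ rt]; rewrite /single finset.setD1K.
  apply: eq_bigl => sigma; apply/idP/idP => [/andP[/andP[P _] /eqP sE]|P].
    rewrite -sE; have := partitionD1 P (setU11 _ _).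
    by congr finset.partition; apply/setP => x; rewrite !inE andbT.
  by rewrite partition_single // setU11 finset.setU1K ?eqxx //; exact: single_notin.
rewrite pair_big_dep /=.
rewrite (reindex_onto (fun p : {set {set T}} * {set T} => insert p.1 p.2)
  (fun theta => let C := finset.pblock theta r in
                (C :\ r |: theta :\ C, C :\ r))) /=; last first.
  move=> theta /andP[P nr].
  have tP := partition_trivIset P.
  have rcov : r \in finset.cover theta by rewrite (cover_partition P) inE.
  have rC : r \in finset.pblock theta r by rewrite mem_pblock.
  have Ct := pblock_mem rcov.
  have C'N : finset.pblock theta r :\ r \notin theta :\ finset.pblock theta r.
    apply/negP => /setD1P[neC C't]; have /set0Pn[x xC'] := partition_neq0 P C't.
    have xC : x \in finset.pblock theta r by move: xC'; rewrite inE => /andP[].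
    by move/eqP: neC; rewrite -(def_pblock tP C't xC') (def_pblock tP Ct xC).
  by rewrite /insert finset.setD1K // finset.setU1K // finset.setD1K.
apply: eq_bigl => -[sigma C] /=; apply/idP/idP.
  set theta := insert sigma C => /andP[/andP[P nr] /eqP[sE CE]].
  have tP := partition_trivIset P.
  have rcov : r \in finset.cover theta by rewrite (cover_partition P) inE.
  have rQ : r \in finset.pblock theta r by rewrite mem_pblock.
  have Qt := pblock_mem rcov.
  rewrite -sE -CE setU11 andbT.
  have -> : [set~ r] =
      (finset.pblock theta r :\ r) :|: ([set: T] :\: finset.pblock theta r).
    apply/setP => x; rewrite !inE andbT.
    by have [->|_] := eqVneq x r; [rewrite rQ | rewrite orbN].
  apply: partitionU1; first exact: partitionD1.
    apply/negP => /eqP Q0; case/negP: nr.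
    by have := Qt; rewrite -(finset.setD1K rQ) Q0 finset.setU0.
  rewrite -setI_eq0; apply/eqP/setP => x; rewrite !inE andbT.
  by case: (x \in _); rewrite ?andbF.
move=> /andP[P Cs]; rewrite partition_insert // single_notin_insert //=.
rewrite (pblock_insert P Cs) (insertK P Cs) /insert.
rewrite finset.setU1K; last exact: insert_notin.
by rewrite finset.setD1K.
Qed.

(** The product only depends on the partition [sigma] induced on the complement of
[r].  If [sigma] has l blocks, leaving [r] alone contributes (-1)^l l!, and
each of the l possible insertions contributes (-1)^(l-1) (l-1)!, so the total
is 0.  The cardinality condition excludes l = 0. *)
Lemma moebius_sum_eq0 (psi : {set T} -> R) :
  (1 < #|T|)%N -> psi finset.set0 = 1 ->
  \sum_(theta | finset.partition theta [set: T])
     mu theta * \prod_(B in theta) psi (B :\ r) = 0.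
Proof.
move=> T1 psi0; rewrite sum_partition_insert big1 // => sigma sigP.
set p := \prod_(C in sigma) psi C.
have psiE C : C \in sigma -> psi (C :\ r) = psi C.
  move=> Cs; congr psi; apply/finset.setDidPl.
  by rewrite disjoint_sym disjoints1 (notin_block sigP).
have -> : \prod_(B in single sigma) psi (B :\ r) = p.
  rewrite /single big_setU1 ?(single_notin sigP) //= finset.setDv psi0 mul1r.
  exact: eq_bigr.
rewrite (eq_bigr
  (fun=> (-1) ^+ (#|sigma| - 1) * ((#|sigma| - 1)`!)%:R * p)); last first.
  move=> C Cs; have cardE : #|insert sigma C| = #|sigma|.
    by rewrite /insert cardsU1 (insert_notin sigP) [RHS](cardsD1 C) Cs.
  rewrite /mu cardE; congr (_ * _); rewrite /insert big_setU1 ?(insert_notin sigP) //=.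
  rewrite (insertK sigP Cs) /p (big_setD1 C Cs) /=; congr (_ * _).
  by apply: eq_bigr => B /setD1P[_]; exact: psiE.
rewrite sumr_const /mu cardsU1 (single_notin sigP) add1n subn1 /=.
have : (0 < #|sigma|)%N.
  rewrite lt0n cards_eq0; apply/negP => /eqP s0.
  have := cover_partition sigP; rewrite s0 /finset.cover big_set0.
  move=> /(congr1 (fun A : {set T} => #|A|)).
  by rewrite cards0 cardsC1; case: #|T| T1 => [|[|]].
case: #|sigma| => // n _; rewrite subn1 /= factS natrM exprS -mulr_natr.
by ring.
Qed.
End Moebius.

(** * Hypertrees *)

Section Hypertrees.
Local Open Scope set_scope.

Lemma exists_collapse_pairs (T : finType) (l : seq (T * T)) :
  exists f : T -> T, (forall p, p \in l -> f p.1 = f p.2) /\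
    (#|T| <= #|f @: [set: T]| + size l)%N.
Proof.
elim: l => [|[i j] l [f [fl le_f]]].
  by exists id; split=> //; rewrite imset_id cardsT addn0.
exists (fun x => if f x == f j then f i else f x); split.
  move=> p; rewrite inE => /orP[/eqP->|/fl E] /=; first by rewrite eqxx; case: ifP.
  by rewrite E.
(* Only the value [f j] is lost when its fibre is merged into that of [f i]. *)
have sub : f @: [set: T] \subset
    f j |: (fun x => if f x == f j then f i else f x) @: [set: T].
  apply/fintype.subsetP => _ /imsetP[x _ ->].
  rewrite in_setU1; case: eqVneq => //= xj.
  by apply/imsetP; exists x => //; rewrite (negPf xj).
apply: leq_trans le_f _; rewrite /= addnS -addSn leq_add2r.
by apply: leq_trans (subset_leq_card sub) _; rewrite cardsU1 -add1n leq_add2r leq_b1.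
Qed.

(** Identifying the entries of [t] with its head takes [size t - 1] identifications.
This is the inequality between the degrees of the hyperedges and the number of
connected components: some function constant along every list takes at least
[#|T| - \sum (size t - 1)] values. *)
Lemma exists_collapse (T : finType) (ts : seq (seq T)) :
  exists f : T -> T, (forall t, t \in ts -> {in t &, forall x y, f x = f y}) /\
    (#|T| <= #|f @: [set: T]| + \sum_(t <- ts) (size t - 1))%N.
Proof.
pose star (t : seq T) := if t is x :: q then [seq (x, y) | y <- q] else [::].
have [f [fl le_f]] := exists_collapse_pairs (flatten [seq star t | t <- ts]).
exists f; split.
  move=> [|x q] //= tts; have fx y : y \in x :: q -> f y = f x.
    rewrite inE => /orP[/eqP-> //|yq]; symmetry; apply: (fl (x, y)).
    by apply/flatten_mapP; exists (x :: q) => //; exact: map_f.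
  by move=> y z /fx -> /fx ->.
apply: leq_trans le_f _.
rewrite size_flatten /shape -map_comp sumnE big_map leq_add2l.
by apply: leq_sum => -[|x q] _ //=; rewrite size_map subn1.
Qed.

Section Parts.
Variables (s : nat) (F : 'I_s -> sgraph) (pi : {set {set dunion F}}).

Lemma big_hypergraph_of (f : {mset 'I_s}%mset -> nat) :
  (\sum_(e <- hypergraph_of pi) f e =
   \sum_(B in pi | 2 <= #|B|) f (seq_mset [seq tag x | x <- enum B]))%N.
Proof.
rewrite /hypergraph_of (perm_big _ (perm_eq_seq_mset _)) /= big_map big_filter.
by rewrite -big_enum_cond.
Qed.

Lemma size_tags (B : {set dunion F}) :
  size (seq_mset [seq tag x | x <- enum B]) = #|B|.
Proof. by rewrite (perm_size (perm_eq_seq_mset _)) size_map -cardE. Qed.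

Hypothesis treeP : hypertree (hypergraph_of pi).

Lemma sum_part_deg : (\sum_(B in pi | 2 <= #|B|) (#|B| - 1) = s - 1)%N.
Proof.
case: treeP => _ _; rewrite big_hypergraph_of card_ord => <-.
by apply: eq_bigr => B _; rewrite /hyperedge_deg size_tags.
Qed.

Lemma hypertree_const (f : 'I_s -> 'I_s) :
  (forall B, B \in pi -> {in B &, forall x y, f (tag x) = f (tag y)}) ->
  forall v w, f v = f w.
Proof.
move=> fB v w; have [-> //|vw] := eqVneq v w.
case: treeP => _ /(_ v w vw) [e [p [allH epath ve wlast]]] _.
have constE (d : {mset 'I_s}%mset) :
    d \in hypergraph_of pi -> {in d &, forall i j, f i = f j}.
  rewrite (perm_mem (perm_eq_seq_mset _)) => /mapP[B]; rewrite mem_filter mem_enum.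
  move=> /andP[_ Bpi] -> i j; rewrite !(perm_mem (perm_eq_seq_mset _)).
  move=> /mapP[x xB ->] /mapP[y yB ->]; apply: (fB B) => //.
    by rewrite -mem_enum.
  by rewrite -mem_enum.
elim: p e v allH epath ve wlast {vw} => [|d p IHp] e v /=.
  by rewrite andbT => eH _ ve we; exact: (constE e).
move=> /andP[eH allH] /andP[/existsP[z /andP[ze zd]] dpath] ve wlast.
by rewrite (constE e eH v z) //; exact: IHp dpath zd wlast.
Qed.

(** A hypertree has no hyperedge incidence to spare.  Removing [x] from its part
[P] lowers the total degree below [s - 1], so some nonconstant [f] is constant
along all that is left; if it did not separate [x] from [y], it would be
constant along [P] as well, hence constant by connectedness. *)
Lemma hypertree_cut (P : {set dunion F}) (x y : dunion F) :
  P \in pi -> x \in P -> y \in P -> x != y ->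
  exists f : 'I_s -> 'I_s,
    (forall Q, Q \in pi -> Q != P -> {in Q &, forall z w, f (tag z) = f (tag w)}) /\
    f (tag x) != f (tag y).
Proof.
move=> Ppi xP yP xy.
pose cut Q := if Q == P then P :\ x else Q.
pose tags Q := [seq tag z | z <- enum (cut Q)].
have [f [fts le_f]] :=
  exists_collapse [seq tags Q | Q <- enum [pred Q in pi | (2 <= #|Q|)%N]].
have fcut Q : Q \in pi -> (2 <= #|Q|)%N ->
    {in cut Q &, forall z w, f (tag z) = f (tag w)}.
  move=> Qpi Q2 z w zQ wQ; apply: (fts (tags Q)).
  - by apply: map_f; rewrite mem_enum inE Qpi.
  - by apply: map_f; rewrite mem_enum.
  - by apply: map_f; rewrite mem_enum.
have P2 : (2 <= #|P|)%N.
  by rewrite (cardsD1 x) xP (cardsD1 y) !inE eq_sym xy yP.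
have fQ Q : Q \in pi -> Q != P -> {in Q &, forall z w, f (tag z) = f (tag w)}.
  move=> Qpi QP z w zQ wQ; case: (leqP 2 #|Q|) => Q2.
    by apply: (fcut Q) => //; rewrite /cut (negPf QP).
  suff -> : z = w by [].
  by move: Q2; rewrite ltnS => /card_le1_eqP; exact.
exists f; split => //; apply/eqP => fxy.
have fconst : forall v w, f v = f w.
  apply: hypertree_const => Q Qpi; have [->|] := eqVneq Q P; last exact: fQ.
  have fy z : z \in P -> f (tag z) = f (tag y).
    move=> zP; have [->//|zx] := eqVneq z x.
    by apply: (fcut P) => //; rewrite /cut eqxx !inE ?zx ?zP // eq_sym xy.
  by move=> z w /fy -> /fy ->.
have im1 : (#|f @: [set: 'I_s]| <= 1)%N.
  apply/card_le1_eqP => _ _ /imsetP[v _ ->] /imsetP[w _ ->]; exact: fconst.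
have s0 : (0 < s)%N by case: (tag x) => m; case: (s).
have : (\sum_(t <- [seq tags Q | Q <- enum [pred Q in pi | (2 <= #|Q|)%N]])
          (size t - 1) < s - 1)%N.
  rewrite big_map big_enum /= -sum_part_deg.
  rewrite (bigD1 P) /= ?inE ?Ppi // [X in (_ < X)%N](bigD1 P) /= ?Ppi //.
  rewrite -addSn leq_add //.
    rewrite /tags size_map -cardE /cut eqxx.
    by move: P2; rewrite (cardsD1 x P) xP add1n !subn1 /= ltn_predL.
  apply: eq_leq; apply: eq_big => [Q|Q /andP[_ QP]]; first by rewrite !inE.
  by rewrite /tags size_map -cardE /cut (negPf QP).
have := leq_trans le_f (leq_add im1 (leqnn _)); rewrite card_ord.
move: (\sum_(t <- _) _)%N => S; lia.
Qed.

Lemma hypertree_tag_inj (P : {set dunion F}) : P \in pi -> {in P &, injective tag}.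
Proof.
move=> Ppi x y xP yP txy; apply/eqP; apply: contraT => xy.
by have [f [_]] := hypertree_cut Ppi xP yP xy; rewrite txy eqxx.
Qed.

(** If [P] and [Q] were distinct, [Q] would still link the tags of [x] and [y]
after the removal of [x] from [P], against [hypertree_cut]. *)
Lemma hypertree_meet_le1 (P Q : {set dunion F}) x y x' y' : P \in pi -> Q \in pi ->
  x \in P -> y \in P -> x' \in Q -> y' \in Q -> tag x = tag x' -> tag y = tag y' ->
  P = Q \/ x = y.
Proof.
move=> Ppi Qpi xP yP xQ yQ tx ty.
have [->|QP] := eqVneq Q P; first by left.
have [->|xy] := eqVneq x y; first by right.
have [f [/(_ Q Qpi QP x' y' xQ yQ) fQ]] := hypertree_cut Ppi xP yP xy.
by rewrite tx ty fQ eqxx.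
Qed.

End Parts.

(** The sum is the number of hyperedges at [r], with multiplicity.  If it were at
least 2 for every [r], the hyperedges would have at least 2s elements in all;
but a hyperedge has at most twice as many elements as its degree, and the
degrees add up to [s - 1]. *)
Lemma hypertree_leaf s (H : hypergraph 'I_s) : (2 <= s)%N -> hypertree H ->
  exists r : 'I_s, (\sum_(e <- H) (e : {mset 'I_s}%mset) r <= 1)%N.
Proof.
move=> s2 [H2 _ sumH]; apply/existsP; apply: contraT.
rewrite negb_exists => /forallP big.
have sizeE (e : {mset 'I_s}%mset) : (\sum_r e r = size e)%N.
  rewrite -sum1_size; under eq_bigr do rewrite -count_mem_mset -sum1_count big_mkcond.
  rewrite exchange_big /=; apply: eq_bigr => i _.
  by rewrite -big_mkcond (big_pred1 i) // => r; rewrite /= eq_sym.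
have : (2 * s <= \sum_(r < s) \sum_(e <- H) (e : {mset 'I_s}%mset) r)%N.
  rewrite mulnC -[s in (s * _)%N]card_ord -sum_nat_const; apply: leq_sum => r _.
  by rewrite ltnNge.
rewrite exchange_big /=; under eq_bigr do rewrite sizeE.
have : (\sum_(e <- H) size (e : {mset 'I_s}%mset) <=
        \sum_(e <- H) 2 * hyperedge_deg e)%N.
  rewrite big_seq [X in (_ <= X)%N]big_seq.
  apply: leq_sum => e /H2; rewrite /hyperedge_deg.
  by move: (size (e : {mset 'I_s}%mset)) => n; lia.
by rewrite -big_distrr /= sumH card_ord => le2 /leq_trans-/(_ _ le2); lia.
Qed.

(** The hypothesis bounds the number of vertices of [F r] that lie in parts with
at least two elements. *)
Lemma leaf_unique s (F : 'I_s -> sgraph) (pi : {set {set dunion F}})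
    (r : 'I_s) x y :
  finset.partition pi [set: dunion F] ->
  (\sum_(e <- hypergraph_of pi) (e : {mset 'I_s}%mset) r <= 1)%N ->
  tag x = r -> tag y = r ->
  (2 <= #|finset.pblock pi x|)%N -> (2 <= #|finset.pblock pi y|)%N -> x = y.
Proof.
move=> piP; rewrite (big_hypergraph_of pi (fun e => e r)) => le1 xr yr x2 y2.
apply/eqP; apply: contraT => xy.
pose E z : nat := (tag z == r) && (2 <= #|finset.pblock pi z|)%N.
suff : (2 <= 1)%N by [].
apply: leq_trans le1.
have -> : (\sum_(B in pi | 2 <= #|B|) seq_mset [seq tag z | z <- enum B] r =
           \sum_(z in [set: dunion F]) E z)%N.
  rewrite (set_partition_big _ piP) /=.
  rewrite [RHS](bigID (fun B : {set _} => (2 <= #|B|)%N)) /=.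
  rewrite [X in (_ + X)%N]big1 ?addn0; last first.
    move=> B /andP[Bpi B2]; rewrite big1 // => z zB.
    by rewrite /E (def_pblock (partition_trivIset piP) Bpi zB) (negPf B2) andbF.
  apply: eq_bigr => B /andP[Bpi B2].
  rewrite mset_seqE -sum1_count big_map big_mkcond big_enum /=.
  apply: eq_bigr => z zB.
  rewrite /E (def_pblock (partition_trivIset piP) Bpi zB) B2 andbT.
  by case: eqP.
rewrite (bigD1 x) ?inE //= (bigD1 y) /= ?inE 1?eq_sym //.
by rewrite {1 2}/E xr yr eqxx x2 y2 /= addnA.
Qed.
End Hypertrees.

(** * Means over independent uniform points *)

Section Cube.
Variable R : realType.
Local Notation TR := (measurableTypeR R).
Local Notation leb := (@lebesgue01 R).

Definition box n (A : 'I_n -> set TR) : set (n.-tuple TR) :=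
  [set x | forall i, A i (tnth x i)].

Lemma measurable_box n (A : 'I_n -> set TR) :
  (forall i, measurable (A i)) -> measurable (box A).
Proof.
move=> mA.
have -> : box A = \big[setI/setT]_(i < n) ((@tnth n TR)^~ i @^-1` A i).
  rewrite -bigcap_seq; apply/seteqP; split=> x /= xA i; first by move=> _; exact: xA.
  by apply: xA; rewrite /= mem_index_enum.
apply: bigsetI_measurable => i _.
by rewrite -[_ @^-1` _]setTI; exact: measurable_tnth.
Qed.

Lemma cube_measure_box n (A : 'I_n -> set TR) :
  (forall i, measurable (A i)) ->
  cube_measure R n (box A) = (\prod_(i < n) leb (A i))%E.
Proof.
elim: n A => [|n IHn] A mA.
  rewrite big_ord0 /= diracE mem_set //.
  by case.
rewrite big_ord_recl -IHn // /distribution /= /pushforward.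
rewrite -product_measure1E //; last exact: measurable_box.
congr (_ _); apply/seteqP; split=> -[t x] /=.
  move=> xA; split; first by have := xA ord0; rewrite tnth0.
  by move=> i; have := xA (lift ord0 i); rewrite tnthS.
case=> tA xA i; case: (unliftP ord0 i) => [j|] ->.
  by rewrite tnthS; exact: xA.
by rewrite tnth0.
Qed.

(** Boxes are stable under intersection and generate the product sigma-algebra. *)
Lemma cube_measure_unique n (m : {measure set (n.-tuple TR) -> \bar R}) :
  (forall A : 'I_n -> set TR, (forall i, measurable (A i)) ->
     m (box A) = (\prod_(i < n) leb (A i))%E) ->
  forall X, measurable X -> cube_measure R n X = m X.
Proof.
move=> mE.
pose G := [set box A | A in [set A : 'I_n -> set TR | forall i, measurable (A i)]].
apply: (measure_unique G (fun=> setT)) => //.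
- apply/seteqP; split; last first.
    apply: smallest_sub; first exact: sigma_algebra_measurable.
    by move=> _ [A mA <-]; exact: measurable_box.
  apply: smallest_sub; first exact: smallest_sigma_algebra.
  move=> X; rewrite -bigcup_seq => -[i _ [Y mY <-]].
  apply: sub_sigma_algebra; exists (fun j => if j == i then Y else setT).
    by move=> j /=; case: ifP.
  rewrite setTI; apply/seteqP; split=> x /=; first by move=> /(_ i); rewrite eqxx.
  by move=> xY j; case: eqP => // ->.
- move=> _ _ [A mA <-] [B mB <-]; exists (fun i => A i `&` B i).
    by move=> i; exact: measurableI.
  apply/seteqP; split=> x /=; first by move=> AB; split=> i; case: (AB i).
  by case=> xA xB i; split; [exact: xA | exact: xB].
- by move=> _; exists (fun=> setT) => //; apply/seteqP; split.
- by rewrite bigcup_const.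
- by move=> _ [A mA <-]; rewrite mE //; exact: cube_measure_box.
- by move=> k; apply: (@le_lt_trans _ _ 1%E); [exact: probability_le1 | exact: ltry].
Qed.

Section Mean.
Implicit Types I J : finType.

(** Coordinates are indexed by an arbitrary finite type, so that vertices of graphs,
or blocks of a partition, can serve as names of variables. *)
Definition coord I (x : #|I|.-tuple TR) : I -> TR :=
  fun i => tnth x (enum_rank i).

Definition tuple_of I (f : I -> TR) : #|I|.-tuple TR :=
  [tuple f (enum_val j) | j < #|I|].

Lemma tuple_ofK I (f : I -> TR) : coord (tuple_of f) = f.
Proof. by apply/funext => i; rewrite /coord tnth_mktuple enum_rankK. Qed.

(** The expectation of [phi] at a family of independent uniform points of [0, 1]
indexed by [I]. *)
Definition mean I (phi : (I -> TR) -> R) : R :=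
  \int[cube_measure R #|I|]_x phi (coord x).

Definition bounded_measurable I (phi : (I -> TR) -> R) : Prop :=
  measurable_fun setT (fun x : #|I|.-tuple TR => phi (coord x)) /\
  exists M, forall x, `|phi x| <= M.

Definition merge I J (x : I -> TR) (y : J -> TR) (s : I + J) : TR :=
  match s with inl i => x i | inr j => y j end.

Lemma measurable_coord I (i : I) :
  measurable_fun setT (fun x : #|I|.-tuple TR => coord x i).
Proof. exact: measurable_tnth. Qed.

Section Merge.
Variables (I J1 J2 : finType) (T : I -> J1 + J2).

Definition merge_tuple (p : #|J1|.-tuple TR * #|J2|.-tuple TR) : #|I|.-tuple TR :=
  tuple_of (merge (coord p.1) (coord p.2) \o T).

Lemma measurable_merge_tuple : measurable_fun setT merge_tuple.
Proof.
apply/measurable_fun_tnthP => i.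
rewrite /comp /merge_tuple /=; under eq_fun do rewrite tnth_mktuple /=.
by case: (T (enum_val i)) => j /=;
  apply: (@measurableT_comp _ _ _ _ _ _ (fun x => coord x j)) => //;
  exact: measurable_coord.
Qed.

HB.instance Definition _ :=
  isMeasurableFun.Build _ _ _ _ merge_tuple measurable_merge_tuple.

Hypothesis injT : injective T.

Lemma prod_enum_rank J (F : J -> \bar R) :
  (\prod_(j < #|J|) F (enum_val j) = \prod_j F j)%E.
Proof.
by rewrite [RHS](reindex (@enum_val J predT)) //; exact/onW_bij/enum_val_bij.
Qed.

(** Selecting distinct coordinates of two independent families gives an
independent family; injectivity of [T] is what keeps the coordinates
independent.  It suffices to compare the measures of boxes. *)
Lemma distribution_merge X : measurable X ->
  cube_measure R #|I| X =
  distribution (cube_measure R #|J1| \x cube_measure R #|J2|)%E merge_tuple X.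
Proof.
move: X; apply: cube_measure_unique => A mA.
(* Coordinates outside the range of [T] are unconstrained. *)
pose B s := if [pick i | T i == s] is Some i then A (enum_rank i) else setT.
have mB s : measurable (B s) by rewrite /B; case: pickP.
have BT i : B (T i) = A (enum_rank i).
  by rewrite /B; case: pickP => [j /eqP/injT->|/(_ i)]; rewrite ?eqxx.
rewrite /distribution /= /pushforward.
have -> : merge_tuple @^-1` box A =
    box (fun j => B (inl (enum_val j))) `*` box (fun j => B (inr (enum_val j))).
  apply/seteqP; split=> -[x y] /=.
    by move=> xyA; split=> j; rewrite /B; case: pickP => // i /eqP Ti;
      have := xyA (enum_rank i); rewrite tnth_mktuple enum_rankK /= Ti /=;
      rewrite /coord enum_valK.
  case=> xB yB i; rewrite tnth_mktuple /= -[i in A i]enum_valK -BT.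
  case: (T _) => j /=.
    by have := xB (enum_rank j); rewrite enum_rankK.
  by have := yB (enum_rank j); rewrite enum_rankK.
rewrite [LHS]product_measure1E; [|exact: measurable_box..].
rewrite [X in (X * _)%E]cube_measure_box // [X in (_ * X)%E]cube_measure_box //.
rewrite (prod_enum_rank (fun j => leb (B (inl j)))).
rewrite (prod_enum_rank (fun j => leb (B (inr j)))).
transitivity (\prod_(s : J1 + J2) leb (B s))%E; first by rewrite big_sumType.
rewrite (bigID (mem (T @: [set: I])%SET)) /= [X in (_ * X)%E]big1 ?mule1; last first.
  move=> s sT; rewrite /B.
  case: pickP => [i /eqP Ti|_]; last exact: probability_setT.
  by case/negP: sT; rewrite -Ti imset_f // finset.in_setT.
rewrite big_imset /=; last by move=> i j _ _ /injT.
transitivity (\prod_(i : I) leb (A (enum_rank i)))%E.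
  by apply: eq_big => [i|i _]; rewrite ?finset.in_setT ?BT.
by rewrite -prod_enum_rank; apply: eq_bigr => i _; rewrite enum_valK.
Qed.

End Merge.

Lemma bm_integrable I (phi : (I -> TR) -> R) : bounded_measurable phi ->
  (cube_measure R #|I|).-integrable setT (EFin \o (fun x => phi (coord x))).
Proof.
case=> mphi [M phiM]; apply: measurable_bounded_integrable => //.
  by apply: (@le_lt_trans _ _ 1%E); [exact: probability_le1 | exact: ltry].
exists M; split; first exact: num_real.
by move=> N MN x _; exact: le_trans (phiM _) (ltW MN).
Qed.

Lemma eq_mean I (phi psi : (I -> TR) -> R) : phi =1 psi -> mean phi = mean psi.
Proof. by move=> /funext ->. Qed.

Lemma bm_cst I (c : R) : @bounded_measurable I (fun=> c).
Proof. by split; [exact: measurable_cst | exists `|c|]. Qed.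

Lemma bmD I (phi psi : (I -> TR) -> R) : bounded_measurable phi ->
  bounded_measurable psi -> bounded_measurable (fun x => phi x + psi x).
Proof.
move=> [mphi [M phiM]] [mpsi [N psiN]]; split; first exact: measurable_funD.
by exists (M + N) => x; apply: le_trans (ler_normD _ _) _; exact: lerD.
Qed.

Lemma bmM I (phi psi : (I -> TR) -> R) : bounded_measurable phi ->
  bounded_measurable psi -> bounded_measurable (fun x => phi x * psi x).
Proof.
move=> [mphi [M phiM]] [mpsi [N psiN]]; split; first exact: measurable_funM.
by exists (M * N) => x; rewrite normrM; exact: ler_pM.
Qed.

Lemma fun_big (A : Type) (op : R -> R -> R) idx (K : finType) (P : pred K)
    (phi : K -> A -> R) :
  (fun x => \big[op/idx]_(k | P k) phi k x) =
  \big[(fun f g x => op (f x) (g x))/(fun=> idx)]_(k | P k) phi k.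
Proof. by apply/funext => x; elim/big_rec2: _ => [//|k f _ _ ->]. Qed.

Lemma bm_sum I (K : finType) (P : pred K) (phi : K -> (I -> TR) -> R) :
  (forall k, P k -> bounded_measurable (phi k)) ->
  bounded_measurable (fun x => \sum_(k | P k) phi k x).
Proof.
move=> mphi; rewrite fun_big.
by apply: big_ind => [|f g|//]; [exact: bm_cst | exact: bmD].
Qed.

Lemma bm_prod I (K : finType) (P : pred K) (phi : K -> (I -> TR) -> R) :
  (forall k, P k -> bounded_measurable (phi k)) ->
  bounded_measurable (fun x => \prod_(k | P k) phi k x).
Proof.
move=> mphi; rewrite fun_big.
by apply: big_ind => [|f g|//]; [exact: bm_cst | exact: bmM].
Qed.

Lemma mean_cst I (c : R) : mean (fun _ : I -> TR => c) = c.
Proof. by rewrite /mean Rintegral_cst // [X in fine X]probability_setT mulr1. Qed.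

Lemma meanD I (phi psi : (I -> TR) -> R) : bounded_measurable phi ->
  bounded_measurable psi -> mean (fun x => phi x + psi x) = mean phi + mean psi.
Proof. by move=> mphi mpsi; apply: RintegralD => //; exact: bm_integrable. Qed.

Lemma meanZ I c (phi : (I -> TR) -> R) : bounded_measurable phi ->
  mean (fun x => c * phi x) = c * mean phi.
Proof. by move=> mphi; apply: RintegralZl => //; exact: bm_integrable. Qed.

Lemma mean_sum I (K : finType) (P : pred K) (phi : K -> (I -> TR) -> R) :
  (forall k, P k -> bounded_measurable (phi k)) ->
  mean (fun x => \sum_(k | P k) phi k x) = \sum_(k | P k) mean (phi k).
Proof.
move=> mphi; rewrite fun_big.
suff [] : bounded_measurable
      (\big[(fun f g x => f x + g x)/fun=> 0]_(k | P k) phi k) /\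
    mean (\big[(fun f g x => f x + g x)/fun=> 0]_(k | P k) phi k) =
      \sum_(k | P k) mean (phi k) by [].
elim/big_rec2: _ => [|k r f Pk [bf fE]].
  by split; [exact: bm_cst | exact: mean_cst].
by split; [apply: bmD => //; exact: mphi | rewrite meanD ?fE //; exact: mphi].
Qed.

Lemma mean_ge0 I (phi : (I -> TR) -> R) : (forall x, 0 <= phi x) -> 0 <= mean phi.
Proof. by move=> phi0; apply: Rintegral_ge0. Qed.

Lemma le_mean I (phi psi : (I -> TR) -> R) : bounded_measurable phi ->
  bounded_measurable psi -> (forall x, phi x <= psi x) -> mean phi <= mean psi.
Proof.
move=> bphi bpsi phipsi; apply: le_Rintegral => //.
  exact: (bm_integrable bphi).
exact: (bm_integrable bpsi).
Qed.

Lemma norm_mean_le I (phi : (I -> TR) -> R) (M : R) : bounded_measurable phi ->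
  (forall x, `|phi x| <= M) -> `|mean phi| <= M.
Proof.
move=> bphi phiM; have MB x : - M <= phi x <= M by rewrite -ler_norml.
have cM c := bm_cst I c.
rewrite ler_norml -{1}(mean_cst I (- M)) -{2}(mean_cst I M).
by apply/andP; split; apply: le_mean => // x; case/andP: (MB x).
Qed.

Section MeanMerge.
Variables (I J1 J2 : finType) (T : I -> J1 + J2) (phi : (I -> TR) -> R).
Hypothesis bphi : bounded_measurable phi.

Let h (p : #|J1|.-tuple TR * #|J2|.-tuple TR) : R := phi (coord (merge_tuple T p)).

Let mh : measurable_fun setT h.
Proof. exact: (measurableT_comp bphi.1 (measurable_merge_tuple T)). Qed.

Let h_integrable :
  (cube_measure R #|J1| \x cube_measure R #|J2|)%E.-integrable setT (EFin \o h).
Proof.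
have [_ [M phiM]] := bphi; apply: measurable_bounded_integrable => //.
  by apply: (@le_lt_trans _ _ 1%E); [exact: probability_le1 | exact: ltry].
exists M; split; first exact: num_real.
by move=> N MN x _; exact: le_trans (phiM _) (ltW MN).
Qed.

Let hE x y : h (x, y) = phi (merge (coord x) (coord y) \o T).
Proof. by rewrite /h /merge_tuple tuple_ofK. Qed.

Lemma bm_section (x : J1 -> TR) : bounded_measurable (fun y => phi (merge x y \o T)).
Proof.
have [_ [M phiM]] := bphi; split; last by exists M.
rewrite (_ : (fun _ => _) = h \o pair (tuple_of x)); last first.
  by apply/funext => y; rewrite /= hE tuple_ofK.
apply: measurableT_comp => //; exact: pair1_measurable.
Qed.

Let FE : (fun x => \int[cube_measure R #|J2|]_y (EFin \o h) (x, y))%E =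
  (fun x => (mean (fun y => phi (merge (coord x) y \o T)))%:E).
Proof.
apply/funext => x; rewrite /mean /Rintegral fineK.
  by apply: eq_integral => y _; rewrite /= hE.
apply: integrable_fin_num => //; exact: (bm_integrable (bm_section (coord x))).
Qed.

Lemma bm_mean : bounded_measurable (fun x => mean (fun y => phi (merge x y \o T))).
Proof.
split; last first.
  have [_ [M phiM]] := bphi; exists M => x; apply: norm_mean_le => //.
  exact: bm_section.
apply/measurable_EFinP; have := measurable_fubini_F h_integrable.
by rewrite /fubini_F FE.
Qed.

(** The change of variables from which all manipulations of means below follow:
renaming variables, adding unused ones, and integrating a fresh group of
variables first. *)
Lemma mean_merge : injective T ->
  mean phi = mean (fun x => mean (fun y => phi (merge x y \o T))).
Proof.
move=> injT; rewrite [LHS]/mean /Rintegral.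
rewrite (eq_measure_integral (distribution
  (cube_measure R #|J1| \x cube_measure R #|J2|)%E (merge_tuple T))); last first.
  by move=> A mA _; exact: distribution_merge.
rewrite integral_distribution //; last by apply/measurable_EFinP; exact: bphi.1.
have := integral12_prod_meas1 h_integrable; rewrite /fubini_F FE => <-.
by [].
Qed.
End MeanMerge.
End Mean.
End Cube.

(** * Rooted densities *)

Section Root.
Variable R : realType.
Local Notation TR := (measurableTypeR R).
Implicit Types I J F : finType.

Lemma bm_comp I J (e : I -> J) (phi : (I -> TR) -> R) :
  bounded_measurable phi -> bounded_measurable (fun x : J -> TR => phi (x \o e)).
Proof.
move=> bphi; have := @bm_section R I void J (inr \o e) phi bphi (of_void TR).
by [].
Qed.

Lemma mean_inj I J (e : I -> J) (phi : (I -> TR) -> R) : injective e ->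
  bounded_measurable phi -> mean phi = mean (fun x : J -> TR => phi (x \o e)).
Proof.
move=> inje bphi; rewrite (@mean_merge R I J void (inl \o e)) //; last first.
  by move=> i i' [] /inje.
by apply: eq_mean => x; exact: (@mean_cst R void (phi (x \o e))).
Qed.

Definition upd F (z : F -> TR) a t : F -> TR := fun b => if b == a then t else z b.

(** With [W] the edge weight of a graph, its homomorphism density conditional on the
vertex [a] being sent to [t]. *)
Definition rooted F (W : (F -> TR) -> R) a t : R := mean (fun z => W (upd z a t)).

Lemma bm_rooted F (W : (F -> TR) -> R) a I (i : I) :
  bounded_measurable W -> bounded_measurable (fun x : I -> TR => rooted W a (x i)).
Proof.
move=> bW; pose T (b : F) : unit + F := if b == a then inl tt else inr b.
apply: (bm_comp (fun _ : unit => i) (phi := fun x => rooted W a (x tt))).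
have := bm_mean T bW; congr (bounded_measurable _); apply/funext => x.
apply: eq_mean => y; congr W; apply/funext => b.
by rewrite /= /T /upd; case: eqP.
Qed.

Lemma bm_upd F (W : (F -> TR) -> R) a t :
  bounded_measurable W -> bounded_measurable (fun z => W (upd z a t)).
Proof.
move=> bW.
have := @bm_section R F unit F
  (fun b => if b == a then inl tt else inr b) W bW (fun=> t).
congr (bounded_measurable _); apply/funext => z; congr W; apply/funext => b.
by rewrite /= /upd; case: eqP.
Qed.

(** The variables [y a] with [a != a0] only occur in [W], so they may be integrated
out first, which leaves the density of [W] rooted at [a0]. *)
Lemma mean_pendant I F (W : (F -> TR) -> R) (phi : (I -> TR) -> R)
    (y : F -> I) a0 :
  bounded_measurable W -> bounded_measurable phi -> injective y ->
  (forall x x', (forall i, (forall a, a != a0 -> y a != i) -> x i = x' i) ->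
     phi x = phi x') ->
  mean (fun x => phi x * W (x \o y)) =
  mean (fun x => phi x * rooted W a0 (x (y a0))).
Proof.
move=> bW bphi injy phi_ext.
(* Variables [y a] with [a != a0] are resampled as a separate family. *)
pose T (i : I) : I + F :=
  if [pick a | (y a == i) && (a != a0)] is Some a then inr a else inl i.
have injT : injective T.
  move=> i i'; rewrite /T; case: pickP => [a /andP[/eqP <- _]|_];
    case: pickP => [b /andP[/eqP <- _]|_] //.
    by case=> ->.
  by case.
rewrite (@mean_merge R I I F T) //; last first.
  by apply: bmM => //; exact: bm_comp.
apply: eq_mean => x; rewrite -meanZ; last exact: bm_upd.
apply: eq_mean => z; congr (_ * _).
  apply: phi_ext => i yi; rewrite /= /T; case: pickP => // a /andP[/eqP ai aa0].
  by move: (yi a aa0); rewrite ai eqxx.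
congr W; apply/funext => b; rewrite /= /T /upd.
case: pickP => [a /andP[/eqP/injy-> /negPf->] //|].
by move=> /(_ b); rewrite eqxx /=; case: eqP => // ->.
Qed.

Lemma mean_point I J (i : I) (j : J) (eta : TR -> R) :
  bounded_measurable (fun x : unit -> TR => eta (x tt)) ->
  mean (fun x : I -> TR => eta (x i)) = mean (fun x : J -> TR => eta (x j)).
Proof.
move=> beta.
have E (K : finType) (k : K) : mean (fun x : unit -> TR => eta (x tt)) =
    mean (fun x : K -> TR => eta (x k)).
  by apply: (mean_inj (e := fun=> k) _ beta); case=> [] [].
by rewrite -(E _ i) -(E _ j).
Qed.

Lemma mean_rooted I F (W : (F -> TR) -> R) a (i : I) :
  bounded_measurable W -> mean (fun x : I -> TR => rooted W a (x i)) = mean W.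
Proof.
move=> bW; rewrite (@mean_point I F i a); last exact: bm_rooted.
have := @mean_pendant F F W (fun=> 1) id a bW (bm_cst _ _) (@inj_id _)
  (fun _ _ _ => erefl).
move=> E; transitivity (mean (fun x => 1 * rooted W a (x a))).
  by apply: eq_mean => x; rewrite mul1r.
by rewrite -E; apply: eq_mean => x; rewrite mul1r.
Qed.

(** Cauchy-Schwarz in the degenerate case: the mean of the square of
[l * h + psi] is nonnegative for every [l] and affine in [l]. *)
Lemma mean_null_orth I (h psi : (I -> TR) -> R) :
  bounded_measurable h -> bounded_measurable psi ->
  mean (fun x => h x * h x) = 0 -> mean (fun x => psi x * h x) = 0.
Proof.
move=> bh bpsi hh0.
set B := mean (fun x => psi x * h x); set C := mean (fun x => psi x * psi x).
have bhh := bmM bh bh; have bph := bmM bpsi bh; have bpp := bmM bpsi bpsi.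
have quad l : 0 <= 2 * l * B + C.
  have : 0 <= mean (fun x => (l * h x + psi x) * (l * h x + psi x)).
    by apply: mean_ge0 => x; rewrite -expr2 sqr_ge0.
  suff -> : mean (fun x => (l * h x + psi x) * (l * h x + psi x)) =
      2 * l * B + C by [].
  transitivity (mean (fun x =>
    l ^+ 2 * (h x * h x) + (2 * l * (psi x * h x) + psi x * psi x))).
    by apply: eq_mean => x; ring.
  rewrite !meanD ?meanZ ?hh0 //; last 3 first.
  - by apply: bmM => //; exact: bm_cst.
  - by apply: bmM => //; exact: bm_cst.
  - by apply: bmD => //; apply: bmM => //; exact: bm_cst.
  by rewrite mulr0 add0r.
(* An affine function of [l] that stays nonnegative is constant. *)
apply/eqP; apply: contraT => B0.
have := quad (- (C + 1) / (2 * B)); rewrite leNgt.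
suff -> : 2 * (- (C + 1) / (2 * B)) * B + C = -1 by rewrite oppr_lt0 ltr01.
by field; rewrite B0.
Qed.
End Root.

(** * Edge weights of graphs *)

Section Weight.
Variable R : realType.
Local Notation TR := (measurableTypeR R).
Implicit Types (I : finType) (G : sgraph).
Variable u : TR * TR -> R.

(** Every edge contributes twice, once for each orientation; [u] will be the square
root of an edge kernel.  No orientation of the edges has to be chosen, which
makes the behaviour under unions and contractions immediate. *)
Definition weight G (x : G -> TR) : R := \prod_v \prod_(w | adj v w) u (x v, x w).

Lemma weight_dunion2 (F1 F2 : sgraph) (x : dunion2 F1 F2 -> TR) :
  weight x = weight (x \o inl) * weight (x \o inr).
Proof.
rewrite /weight big_sumType /=; congr (_ * _); apply: eq_bigr => a _.
  by rewrite big_sumType /= [X in _ * X]big_pred0 ?mulr1.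
by rewrite big_sumType /= [X in X * _]big_pred0 ?mul1r.
Qed.

Lemma weight_dunion (J : finType) (F : J -> sgraph) (x : dunion F -> TR) :
  weight x = \prod_r weight (fun a : F r => x (Tagged (fun r => vertex (F r)) a)).
Proof.
rewrite /weight (sig_big_dep _ (fun _ => xpredT)
  (fun r (a : F r) => \prod_(b | adj a b)
    u (x (Tagged (fun r => vertex (F r)) a), x (Tagged (fun r => vertex (F r)) b)))) /=.
apply: eq_bigr => -[r a] _ /=.
pose P (v : dunion F) := adj (Tagged (fun r => vertex (F r)) a : dunion F) v.
rewrite (reindex_onto (Tagged (fun r => vertex (F r)) (i := r))
  (fun v => tagged_as (Tagged (fun r => vertex (F r)) a) v)) /=.
  apply: eq_bigl => b; rewrite /dunion_adj /= eqxx /=.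
  by rewrite (@tagged_asE _ _ (Tagged (fun r => vertex (F r)) a) b) eqxx andbT.
move=> [r' b]; rewrite /dunion_adj /= => /andP[/eqP rr' _]; subst r'.
by rewrite (@tagged_asE _ _ (Tagged (fun r => vertex (F r)) a) b).
Qed.

Hypothesis mu : measurable_fun setT u.
Hypothesis u01 : forall p, 0 <= u p <= 1.

Lemma bm_weight G : bounded_measurable (@weight G).
Proof.
apply: bm_prod => v _; apply: bm_prod => w _; split.
  apply: (measurableT_comp mu); apply/measurable_fun_pair; exact: measurable_coord.
by exists 1 => x; have /andP[u0 u1] := u01 (x v, x w); rewrite ger0_norm.
Qed.

(** When no two edges of [G] become parallel and none becomes a loop, the edges of
the contracted graph are those of [G], so the contraction amounts to evaluating
the weight of [G] with equal variables in each block, [q] naming the blocks. *)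
Lemma mean_contract G (rho : {set {set G}}) I (q : G -> I) :
  finset.partition rho [set: G]%SET ->
  (forall v w, q v = q w <-> finset.pblock rho v = finset.pblock rho w) ->
  (forall v w : G, adj v w -> q v <> q w) ->
  (forall v w v' w' : G, adj v w -> adj v' w' -> q v = q v' -> q w = q w' ->
     v = v' /\ w = w') ->
  mean (@weight (Defs.contract rho)) = mean (fun x : I -> TR => weight (x \o q)).
Proof.
move=> /and3P[/eqP covrho trivrho rho0] qE noloop edge_inj.
have qP v w : finset.pblock rho v = finset.pblock rho w -> q v = q w by move/qE.
have cov v : v \in finset.cover rho by rewrite covrho finset.in_setT.
have ne (B : Defs.contract rho) : exists v, v \in val B.
  by apply/set0Pn; apply: contraNneq rho0 => <-; exact: (valP B).
pose rep B : G := xchoose (ne B).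
have repB B : finset.pblock rho (rep B) = val B.
  apply: def_pblock => //; [exact: (valP B) | exact: (xchooseP (ne B))].
rewrite (@mean_inj R _ I (q \o rep) (@weight (Defs.contract rho))); last 2 first.
- by move=> B C /qE; rewrite !repB => /val_inj.
- exact: bm_weight.
apply: eq_mean => x; rewrite /weight /=.
pose blk v : Defs.contract rho := Sub (finset.pblock rho v) (pblock_mem (cov v)).
pose k (p : G * G) := (blk p.1, blk p.2).
rewrite !pair_big_dep /=.
pose E := [set p : G * G | adj p.1 p.2]%SET.
have kinj : {in E &, injective k}.
  move=> [v w] [v' w']; rewrite !inE /= => vw vw' kE.
  have vv' := congr1 (fun p => sval p.1) kE.
  have ww' := congr1 (fun p => sval p.2) kE.
  by have [-> ->] := edge_inj _ _ _ _ vw vw' (qP _ _ vv') (qP _ _ ww').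
rewrite [LHS](eq_bigl (mem (k @: E))); last first.
  case=> B C; apply/andP/imsetP => /=.
    case=> BC /existsP[v /andP[vB /existsP[w /andP[wC vw]]]].
    exists (v, w); first by rewrite inE.
    by congr (_, _); apply: val_inj => /=; apply/esym/def_pblock => //; exact: valP.
  case=> -[v w]; rewrite inE /= => vw [-> ->]; split.
    by apply/eqP => /(congr1 sval) /= /qP; exact: noloop.
  apply/existsP; exists v; rewrite /= mem_pblock cov; apply/existsP; exists w.
  by rewrite /= mem_pblock cov.
rewrite big_imset //=; apply: eq_big => [p|p _]; first by rewrite inE.
have qrep v : q (rep (blk v)) = q v by apply: qP; rewrite repB.
by rewrite !qrep.
Qed.

Section Bowtie.
Variables (F1 F2 : sgraph) (i1 : F1) (i2 : F2).
Local Notation W1 := (@weight F1).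
Local Notation W2 := (@weight F2).

Lemma mean_dunion2 : mean (@weight (dunion2 F1 F2)) = mean W1 * mean W2.
Proof.
rewrite (@mean_merge R (dunion2 F1 F2) F1 F2 id); [|exact: bm_weight|exact: inj_id].
rewrite mulrC -meanZ; last exact: bm_weight.
apply: eq_mean => x; rewrite mulrC -meanZ; last exact: bm_weight.
by apply: eq_mean => y; rewrite weight_dunion2.
Qed.

(** Conditionally on the common vertex the two graphs are independent. *)
Lemma mean_bowtie : mean (@weight (bowtie i1 i2)) =
  mean (fun x : unit -> TR => rooted W1 i1 (x tt) * rooted W2 i2 (x tt)).
Proof.
pose q (v : dunion2 F1 F2) : dunion2 F1 F2 := if v == inr i2 then inl i1 else v.
pose P : {set dunion2 F1 F2} := [set inl i1; inr i2]%SET.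
have Pne : inl i1 \in P by rewrite !inE eqxx.
have memG (B : {set dunion2 F1 F2}) : B \in Defs.glue i1 i2 ->
    B = P \/ exists2 v, v \notin P & B = [set v]%SET.
  rewrite /Defs.glue in_setU1 => /orP[/eqP->|/imsetP[v]]; first by left.
  by rewrite finset.in_setC => vP ->; right; exists v.
have PG : P \in Defs.glue i1 i2 by rewrite /Defs.glue in_setU1 eqxx.
have sG v : v \notin P -> [set v]%SET \in Defs.glue i1 i2.
  by move=> vP; rewrite /Defs.glue in_setU1 imset_f ?orbT // finset.in_setC.
have Gtriv : finset.trivIset (Defs.glue i1 i2).
  apply/finset.trivIsetP => A B /memG[->|[v vP ->]] /memG[->|[w wP ->]] neAB.
  - by rewrite eqxx in neAB.
  - by rewrite disjoint_sym disjoints1.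
  - by rewrite disjoints1.
  - by rewrite disjoints1 inE; apply: contra neAB => /eqP->.
have blkP (v : dunion2 F1 F2) :
    finset.pblock (Defs.glue i1 i2) v = if v \in P then P else [set v]%SET.
  case: ifPn => vP; apply: def_pblock => //; first exact: sG.
  by rewrite inE.
have Gpart : finset.partition (Defs.glue i1 i2) [set: dunion2 F1 F2]%SET.
  apply/and3P; split => //.
    apply/eqP/setP => v; rewrite finset.in_setT; apply/bigcupP.
    case: (boolP (v \in P)) => vP; first by exists P.
    by exists [set v]%SET; [exact: sG | exact: set11].
  apply/negP => /memG[P0|[v _ v0]]; first by rewrite -P0 inE in Pne.
  by have := set11 v; rewrite -v0 inE.
have q_eq v w : q v = q w ->
    [\/ v = w, v = inl i1 /\ w = inr i2 | v = inr i2 /\ w = inl i1].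
  rewrite /q; have [->|_] := eqVneq v (inr i2);
    have [->|_] := eqVneq w (inr i2); try by constructor 1.
    by move=> <-; constructor 3.
  by move=> ->; constructor 2.
have q_ker v w : q v = q w <->
    finset.pblock (Defs.glue i1 i2) v = finset.pblock (Defs.glue i1 i2) w.
  split=> [/q_eq[->|[-> ->]|[-> ->]] //|]; [by rewrite !blkP !inE !eqxx orbT..|].
  rewrite !blkP; case: ifPn => vP; case: ifPn => wP;
    [move=> _|move=> P1|move=> P1|by move/set1_inj ->].
  - by move: vP wP; rewrite !inE /q => /orP[]/eqP-> /orP[]/eqP->; rewrite ?eqxx.
  - by move: wP; rewrite P1 set11.
  - by move: vP; rewrite -P1 set11.
have q_loop (v w : dunion2 F1 F2) : adj v w -> q v <> q w.
  move=> vw /q_eq[vE|[vE wE]|[vE wE]]; move: vw; rewrite vE ?wE //.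
  by rewrite adj_irr.
have q_inj (v w v' w' : dunion2 F1 F2) : adj v w -> adj v' w' ->
    q v = q v' -> q w = q w' -> v = v' /\ w = w'.
  move=> vw vw' /q_eq vv /q_eq ww; move: vw vw'.
  by case: vv ww => [->|[-> ->]|[-> ->]] [->|[-> ->]|[-> ->]] //=;
    rewrite ?adj_irr //;
    case: w v' w' => [?|?] [?|?] [?|?].
rewrite /bowtie (mean_contract Gpart q_ker q_loop q_inj).
rewrite (@mean_merge R (dunion2 F1 F2) F1 F2 id);
  [|exact: bm_comp (bm_weight _)|exact: inj_id].
transitivity (mean (fun x : F1 -> TR => rooted W2 i2 (x i1) * W1 (x \o id))).
  apply: eq_mean => x; rewrite mulrC -meanZ; last exact/bm_upd/bm_weight.
  apply: eq_mean => y; rewrite weight_dunion2; congr (weight _ * weight _).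
  apply/funext => b; rewrite /= /q /upd.
  have -> : (inr b == inr i2 :> dunion2 F1 F2) = (b == i2) by [].
  by case: (b == i2).
rewrite (mean_pendant (W := W1) (phi := fun x => rooted W2 i2 (x i1))
  (y := id) (a0 := i1)) //; [|exact: bm_weight|exact/bm_rooted/bm_weight|]; last first.
  by move=> x x' /(_ i1) -> // a /eqP ai /eqP.
rewrite (mean_point
  (eta := fun t => rooted W2 i2 t * rooted W1 i1 t) i1 tt); last first.
  by apply: bmM; exact/bm_rooted/bm_weight.
by apply: eq_mean => x; rewrite mulrC.
Qed.
End Bowtie.
End Weight.

(** * Densities in a singular graphon *)

Section Density.
Variable R : realType.
Local Notation TR := (measurableTypeR R).
Implicit Types (g : graph_function R) (F : sgraph).
Local Notation square := (@unit_itv R `*` @unit_itv R).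

(** A square root, so that the two orientations of an edge together contribute the
value of the graph function.  The value 0 outside the unit square makes it
measurable, with values in [0, 1], on the whole plane. *)
Definition edge_root g (p : TR * TR) : R :=
  (if p \in square then g p else 0) `^ 2^-1.

Lemma measurable_unit_itv : measurable (@unit_itv R).
Proof. exact: measurable_itv. Qed.

Lemma measurable_edge_root g : measurable_fun setT (edge_root g).
Proof.
apply: (measurableT_comp (@measurable_powR R 2^-1)).
have msq : measurable square by apply: measurableX; exact: measurable_unit_itv.
have sqE : [set p | p \in square] = square.
  by apply/seteqP; split => p; rewrite /= inE.
apply: measurable_fun_if => //.
- by apply: (measurable_fun_bool true); rewrite setTI /preimage /= sqE.
- by rewrite setTI /preimage /= sqE; exact: gfun_meas.
Qed.

Lemma edge_root01 g p : 0 <= edge_root g p <= 1.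
Proof.
rewrite /edge_root; case: ifPn => [/set_mem|_]; last first.
  by rewrite powR0 ?ler01 ?lexx //= invr_eq0.
case: p => s t [/= s01 t01]; have /andP[g0 g1] := gfun_01 g s01 t01.
rewrite powR_ge0 /=; rewrite powR12_sqrt // -sqrtr1; exact: ler_wsqrtr.
Qed.

Lemma edge_rootM g s t : unit_itv s -> unit_itv t ->
  edge_root g (s, t) * edge_root g (t, s) = g (s, t).
Proof.
move=> s01 t01; have /andP[g0 _] := gfun_01 g s01 t01.
rewrite /edge_root !mem_set //= -(gfun_sym g s01 t01) powR12_sqrt //.
by rewrite -expr2 sqr_sqrtr.
Qed.

Lemma cube_box n : @cube R n = box (fun=> @unit_itv R).
Proof. by []. Qed.

Lemma leb_unit_itv : lebesgue01 (@unit_itv R) = 1%E.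
Proof. by rewrite -lebesgue01_setT /lebesgue01 /mrestr setTI setIid. Qed.

Lemma hom_density_funE F g : hom_density_fun F g = mean (@weight R (edge_root g) F).
Proof.
have bW := bm_weight (measurable_edge_root g) (edge_root01 g) F.
have mcube : measurable (@cube R #|F|) 
  by rewrite cube_box; apply: measurable_box => i; exact: measurable_unit_itv.
have cube1 : cube_measure R #|F| (@cube R #|F|) = 1%E.
  rewrite cube_box cube_measure_box => [|i]; last exact: measurable_unit_itv.
  by rewrite big1 // => i _; exact: leb_unit_itv.
rewrite /mean /Rintegral.
rewrite (@negligible_integral _ _ _ _ setT (~` @cube R #|F|)) //; last 3 first.
- exact: measurableC.
- exact: bm_integrable.
- by rewrite [LHS]probability_setC // [X in (1 - X)%E]cube1 subee.
rewrite setDE setCK setTI; congr fine; apply: eq_integral => x /set_mem xc.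
congr (_%:E); symmetry; rewrite /weight pair_big_dep /=.
(* The two orientations of each edge are multiplied together. *)
rewrite (bigID (fun p => enum_rank p.1 < enum_rank p.2)%N) /=.
rewrite [X in _ * X](reindex_inj (h := fun p => (p.2, p.1))) /=; last first.
  by move=> [a b] [a' b'] [-> ->].
rewrite [X in _ * X](eq_bigl
  (fun p => adj p.1 p.2 && (enum_rank p.1 < enum_rank p.2)%N)).
  rewrite -big_split /=; apply: eq_bigr => p _.
  by rewrite edge_rootM //; exact: xc.
move=> [a b] /=; rewrite adj_sym; case ab: (adj a b) => //=.
rewrite -leqNgt ltn_neqAle; case: eqP => //= /ord_inj/enum_rank_inj ab'.
by rewrite ab' adj_irr in ab.
Qed.

Variables (gamma : graphon R).
Local Notation W := (@weight R (edge_root (graphon_repr gamma))).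

Lemma hom_densityE F : hom_density F gamma = mean (@W F).
Proof. exact: hom_density_funE. Qed.

Let bW F : bounded_measurable (@W F).
Proof. apply: bm_weight; [exact: measurable_edge_root | exact: edge_root01]. Qed.

(** A singular graphon makes the sum over the roots [a] of the densities rooted at
[a] constant.  This sum has mean [#|F| * t(F)], and by singularity with both
graphs equal to [F] its second moment is the square of that mean: its variance
is 0, so replacing it by its mean changes no mean of a product. *)
Lemma singular_sum_rooted F (I : finType) (i : I) (psi : (I -> TR) -> R) :
  singular gamma -> (0 < #|F|)%N -> bounded_measurable psi ->
  mean (fun x => psi x * \sum_a rooted (@W F) a (x i)) =
  #|F|%:R * mean (@W F) * mean psi.
Proof.
move=> sing F0 bpsi; set k : R := #|F|%:R; set t := mean (@W F).
have k0 : k != 0 by rewrite pnatr_eq0 -lt0n.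
pose S s := \sum_a rooted (@W F) a s.
have bS (J : finType) (j : J) : bounded_measurable (fun x : J -> TR => S (x j)).
  by apply: bm_sum => a _; exact: bm_rooted.
have mS (J : finType) (j : J) : mean (fun x : J -> TR => S (x j)) = k * t.
  rewrite mean_sum => [|a _]; last exact: bm_rooted.
  rewrite (eq_bigr (fun=> t)) => [|a _]; last exact: mean_rooted.
  by rewrite sumr_const mulr_natl.
have SS : mean (fun x : I -> TR => S (x i) * S (x i)) = (k * t) ^+ 2.
  have := sing F F F0 F0; rewrite !hom_densityE.
  rewrite mean_dunion2; [|exact: measurable_edge_root|exact: edge_root01].
  rewrite -/t natrM -/k => E.
  transitivity (\sum_(a : F) \sum_(b : F) hom_density (bowtie a b) gamma);
    last first.
    by apply: (mulfI (invr_neq0 (mulf_neq0 k0 k0))); rewrite -E; field.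
  rewrite (@mean_point _ I unit i tt (fun s => S s * S s)); last by apply: bmM.
  rewrite (eq_mean (psi := fun x : unit -> TR =>
    \sum_a \sum_b rooted (@W F) a (x tt) * rooted (@W F) b (x tt))); last first.
    by move=> x; rewrite /S mulr_suml; apply: eq_bigr => a _; rewrite mulr_sumr.
  rewrite mean_sum => [|a _]; last first.
    by apply: bm_sum => b _; apply: bmM; exact: bm_rooted.
  apply: eq_bigr => a _; rewrite mean_sum => [|b _]; last first.
    by apply: bmM; exact: bm_rooted.
  apply: eq_bigr => b _; rewrite hom_densityE mean_bowtie //.
    exact: measurable_edge_root.
  exact: edge_root01.
pose h (x : I -> TR) := S (x i) + - (k * t).
have bh : bounded_measurable h by apply: bmD => //; exact: bm_cst.
have hh0 : mean (fun x => h x * h x) = 0.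
  rewrite (eq_mean (psi := fun x =>
    S (x i) * S (x i) + (-2 * (k * t) * S (x i) + (k * t) ^+ 2))); last first.
    by move=> x; rewrite /h; ring.
  have bc c := @bm_cst R I c.
  have bL : bounded_measurable (fun x : I -> TR => -2 * (k * t) * S (x i)).
    by apply: bmM.
  rewrite meanD; [|by apply: bmM|exact: bmD].
  by rewrite SS meanD // mean_cst meanZ // mS; ring.
have := mean_null_orth bh bpsi hh0.
rewrite (eq_mean (psi := fun x => psi x * S (x i) + - (k * t) * psi x)); last first.
  by move=> x; rewrite /h; ring.
rewrite meanD ?meanZ //; [|by apply: bmM|by apply: bmM => //; exact: bm_cst].
by rewrite mulNr => /eqP; rewrite subr_eq0 => /eqP.
Qed.
End Density.

(** * Averaging over the attachment of a leaf *)

(** The image of [a0] under a uniform permutation is uniform. *)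
Lemma sum_perm_uniform (R : pzSemiRingType) (T : finType) (f : T -> R) (a0 : T) :
  #|T|%:R * \sum_(tau : {perm T}) f (tau a0) = #|{perm T}|%:R * \sum_a f a.
Proof.
have E a : \sum_(tau : {perm T}) f (tau a) = \sum_(tau : {perm T}) f (tau a0).
  rewrite (reindex_inj (mulgI (tperm a0 a))); apply: eq_bigr => tau _.
  by rewrite permM tpermR.
transitivity (\sum_a \sum_(tau : {perm T}) f (tau a)).
  by rewrite (eq_bigr _ (fun a _ => E a)) sumr_const mulr_natl.
rewrite exchange_big /= (eq_bigr (fun=> \sum_a f a)) ?sumr_const ?mulr_natl //.
move=> tau _.
by rewrite [RHS](reindex_inj (@perm_inj _ tau)).
Qed.

Section Core.
Local Open Scope set_scope.
Variables (R : realType) (gamma : graphon R) (s : nat) (F : 'I_s -> sgraph).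
Local Notation TR := (measurableTypeR R).
Local Notation V := (dunion F).
Local Notation vtx r a := (Tagged (fun i : 'I_s => vertex (F i)) (i := r) a : V).
Local Notation W r := (@weight R (edge_root (graphon_repr gamma)) (F r)).
Implicit Types (pi : {set {set V}}) (B : {set 'I_s}).

Let bW r : bounded_measurable (W r).
Proof. apply: bm_weight; [exact: measurable_edge_root | exact: edge_root01]. Qed.

Lemma vtx_inj r : injective (fun a => vtx r a).
Proof. by move=> a b; exact: (@eq_from_Tagged _ (fun i => vertex (F i)) r a b). Qed.

Section Block.
Variables (B : {set 'I_s}) (pi : {set {set V}}).
Local Notation incl := (@block_incl s F B).

Lemma block_incl_inj : injective incl.
Proof.
move=> [[r rB] a] [[r' rB'] a'] E; have /= rr' := congr1 tag E; subst r'.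
rewrite (bool_irrelevance rB' rB) in a' E *.
by have -> : a = a' := @eq_from_Tagged _ (fun r => vertex (F r)) r a a' E.
Qed.

Lemma adj_block_unionP (v w : block_union F B) :
  adj v w -> tag (incl v) = tag (incl w) /\ v <> w.
Proof.
move=> vw; split; last by move=> E; rewrite E adj_irr in vw.
by case/andP: vw => /eqP E _; rewrite /block_incl /= E.
Qed.

Hypothesis piP : finset.partition pi [set: V].

Lemma pblockP (v : V) : v \in finset.pblock pi v /\ finset.pblock pi v \in pi.
Proof.
have vcov : v \in finset.cover pi by rewrite (cover_partition piP).
by rewrite mem_pblock vcov pblock_mem.
Qed.

Lemma mem_block_trace v : incl @^-1: finset.pblock pi (incl v) \in block_trace B pi.
Proof.
rewrite in_setD1 imset_f ?(pblockP _).2 // andbT; apply/set0Pn; exists v.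
by rewrite inE (pblockP _).1.
Qed.

Lemma block_trace_partition :
  finset.partition (block_trace B pi) [set: block_union F B].
Proof.
apply/and3P; split; last by rewrite in_setD1 eqxx.
  apply/eqP/setP => v; rewrite inE; apply/bigcupP.
  eexists; first exact: (mem_block_trace v).
  by rewrite inE (pblockP _).1.
apply/finset.trivIsetP => _ _ /setD1P[_ /imsetP[P Ppi ->]]
  /setD1P[_ /imsetP[Q Qpi ->]] PQ.
rewrite -setI_eq0; apply: contraNT PQ => /set0Pn[v]; rewrite !inE => /andP[vP vQ].
have tP := partition_trivIset piP.
by rewrite -(def_pblock tP Ppi vP) (def_pblock tP Qpi vQ).
Qed.

Lemma pblock_block_trace v :
  finset.pblock (block_trace B pi) v = incl @^-1: finset.pblock pi (incl v).
Proof.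
apply: def_pblock; first exact: partition_trivIset block_trace_partition.
  exact: mem_block_trace.
by rewrite inE (pblockP _).1.
Qed.

(** Two vertices of one graph never share a part, and two graphs meet in at most
one part; hence contracting along [pi] neither creates loops nor merges edges.
The function [q] names the parts of [pi] by the variables of the integral. *)
Lemma hom_density_block (I : finType) (q : V -> I) : hypertree (hypergraph_of pi) ->
  (forall v w, q v = q w <-> finset.pblock pi v = finset.pblock pi w) ->
  hom_density (Defs.contract (block_trace B pi)) gamma =
  mean (fun x : I -> TR => \prod_(r in B) W r (fun a => x (q (vtx r a)))).
Proof.
move=> treeP qE; rewrite hom_densityE.
have tP := partition_trivIset piP.
have tinj v w : finset.pblock pi v = finset.pblock pi w -> tag v = tag w -> v = w.
  move=> E tvw; apply: (hypertree_tag_inj treeP (pblockP w).2 _ (pblockP w).1 tvw).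
  by rewrite -E; exact: (pblockP v).1.
rewrite (@mean_contract _ _ _ _ _ _ _ (q \o incl)) //; first last.
- move=> v w v' w' /adj_block_unionP[tvw nvw] 
    /adj_block_unionP[tvw' nvw'] /qE Ev /qE Ew.
  have PQ : finset.pblock pi (incl v) <> finset.pblock pi (incl w).
    by move=> E; apply: nvw; apply: block_incl_inj; exact: tinj.
  have [v1 v2] := pblockP (incl v); have [w1 w2] := pblockP (incl w).
  have [v1' _] := pblockP (incl v'); have [w1' _] := pblockP (incl w').
  rewrite -Ev in v1'; rewrite -Ew in w1'.
  split; apply: block_incl_inj.
    by case: (hypertree_meet_le1 treeP v2 w2 v1 v1' w1 w1' tvw tvw').
  by case: (hypertree_meet_le1 treeP w2 v2 w1 w1' v1 v1' (esym tvw) (esym tvw'))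
    => [/esym|].
- move=> v w /adj_block_unionP[tvw nvw] /qE E; apply: nvw; apply: block_incl_inj.
  exact: tinj.
- move=> v w /=; split; first by move/qE => E; rewrite !pblock_block_trace E.
  rewrite !pblock_block_trace => E; apply/qE.
  apply: same_pblock => //.
  have : v \in incl @^-1: finset.pblock pi (incl v) by rewrite inE (pblockP _).1.
  by rewrite E inE.
- exact: block_trace_partition.
- exact: edge_root01.
- exact: measurable_edge_root.
apply: eq_mean => x; rewrite weight_dunion [RHS]big_sub /=.
by apply: eq_bigr => r _.
Qed.
End Block.

Section Relabel.
Variables (r : 'I_s).
Implicit Types (sigma : {perm F r}).

(** The permutation of all vertices that acts by [sigma] on [F r] only. *)
Definition relabel sigma (v : V) : V :=
  vtx (tag v) (eqtype.dfwith (fun k => 1%g : {perm F k}) sigma (tag v) (tagged v)).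

Definition relabel_partition sigma pi :=
  [set relabel sigma @^-1: P | P : {set V} in pi].

Lemma relabel_in sigma a : relabel sigma (vtx r a) = vtx r (sigma a).
Proof. by rewrite /relabel /= eqtype.dfwith_in. Qed.

Lemma relabel_out sigma r' a : r' != r -> relabel sigma (vtx r' a) = vtx r' a.
Proof. by move=> rr'; rewrite /relabel /= eqtype.dfwith_out 1?eq_sym // perm1. Qed.

Lemma relabel_inj sigma : injective (relabel sigma).
Proof.
move=> [i a] [j b] E; have /= ij := congr1 tag E; subst j.
move/eqP: E; rewrite /relabel -tag_eqE /tag_eq /= eqxx /= tagged_asE.
by move=> /eqP /perm_inj ->.
Qed.

Lemma relabel_surj sigma v : exists w, relabel sigma w = v.
Proof. by have [g _ gK] := injF_bij (@relabel_inj sigma); exists (g v). Qed.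

Lemma relabel_partition_inj sigma : injective (relabel_partition sigma).
Proof.
apply: imset_inj => P Q E; apply/setP => v; have [w <-] := relabel_surj sigma v.
by have /setP/(_ w) := E; rewrite !inE.
Qed.

Section Pi.
Variables (sigma : {perm F r}) (pi : {set {set V}}).
Hypothesis piP : finset.partition pi [set: V].

Lemma relabel_partitionP : finset.partition (relabel_partition sigma pi) [set: V].
Proof.
have tP := partition_trivIset piP.
apply/and3P; split.
- apply/eqP/setP => v; rewrite inE; apply/bigcupP.
  have [m1 m2] := pblockP piP (relabel sigma v).
  exists (relabel sigma @^-1: finset.pblock pi (relabel sigma v)).
    exact: imset_f.
  by rewrite inE.
- apply/finset.trivIsetP => _ _ /imsetP[P Ppi ->] /imsetP[Q Qpi ->] PQ.
  rewrite -setI_eq0; apply: contraNT PQ => /set0Pn[v]; rewrite !inE => /andP[vP vQ].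
  by rewrite -(def_pblock tP Ppi vP) (def_pblock tP Qpi vQ).
- apply/negP => /imsetP[P Ppi P0]; have /set0Pn[v vP] := partition_neq0 piP Ppi.
  have [w wv] := relabel_surj sigma v.
  by have := finset.in_set0 w; rewrite P0 inE wv vP.
Qed.

Lemma pblock_relabel v : finset.pblock (relabel_partition sigma pi) v =
  relabel sigma @^-1: finset.pblock pi (relabel sigma v).
Proof.
have [m1 m2] := pblockP piP (relabel sigma v).
apply: def_pblock; first exact: partition_trivIset relabel_partitionP.
  exact: imset_f.
by rewrite inE.
Qed.

End Pi.

Lemma hypergraph_relabel sigma pi :
  hypergraph_of (relabel_partition sigma pi) = hypergraph_of pi.
Proof.
apply/eq_seq_msetP.
pose pre (P : {set V}) := relabel sigma @^-1: P.
have preinj : injective pre.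
  move=> P Q E; apply/setP => v; have [w <-] := relabel_surj sigma v.
  by have /setP/(_ w) := E; rewrite !inE.
have imP (P : {set V}) : relabel sigma @: pre P = P.
  apply/setP => v; apply/imsetP/idP => [[w wP ->]|vP]; first by rewrite inE in wP.
  by have [w wv] := relabel_surj sigma v; exists w; rewrite ?inE wv.
have cardpre (P : {set V}) : #|pre P| = #|P|.
  by rewrite -{2}(imP P) card_imset //; exact: relabel_inj.
have permE : perm_eq (enum (relabel_partition sigma pi)) (map pre (enum pi)).
  apply: uniq_perm; rewrite ?enum_uniq ?map_inj_uniq ?enum_uniq //.
  move=> P; rewrite mem_enum; apply/imsetP/mapP => -[Q Qpi ->]; exists Q => //.
    by rewrite mem_enum.
  by rewrite -mem_enum.
apply: (perm_trans (perm_map _ (perm_filter _ permE))).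
rewrite filter_map -map_comp.
rewrite (eq_filter (a2 := fun P : {set V} => (2 <= #|P|)%N)); last first.
  by move=> P /=; rewrite cardpre.
rewrite (eq_map (g := fun P : {set V} => seq_mset [seq tag x | x <- enum P])) //.
move=> P /=.
apply/eq_seq_msetP.
have : perm_eq (map (relabel sigma) (enum (pre P))) (enum P).
  apply: uniq_perm; rewrite ?enum_uniq ?map_inj_uniq ?enum_uniq //.
    exact: relabel_inj.
  move=> v; rewrite mem_enum -{2}(imP P).
  apply/mapP/imsetP => -[w wP ->]; exists w => //.
    by rewrite -mem_enum.
  by rewrite mem_enum.
by move/(perm_map tag); rewrite -map_comp.
Qed.

(** Relabelling the vertices of [F r] permutes the partitions with hypergraph [H],
because it keeps the index of every vertex. *)
Lemma sum_relabel (H : hypergraph 'I_s) sigma (f : {set {set V}} -> R) :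
  \sum_(pi : {set {set V}} |
          finset.partition pi [set: V] && (hypergraph_of pi == H)) f pi =
  \sum_(pi : {set {set V}} |
          finset.partition pi [set: V] && (hypergraph_of pi == H))
     f (relabel_partition sigma pi).
Proof.
pose S := [set pi : {set {set V}} |
  finset.partition pi [set: V] && (hypergraph_of pi == H)].
have im : relabel_partition sigma @: S = S.
  apply/eqP; rewrite eqEcard card_imset ?leqnn ?andbT; last first.
    exact: relabel_partition_inj.
  apply/fintype.subsetP => _ /imsetP[pi + ->]; rewrite !inE => /andP[piP piH].
  by rewrite relabel_partitionP // hypergraph_relabel.
transitivity (\sum_(pi in S) f pi); first by apply: eq_bigl => pi; rewrite inE.
rewrite -{1}im big_imset /=; last by move=> ? ? _ _; exact: relabel_partition_inj.
by apply: eq_bigl => pi; rewrite inE.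
Qed.

Section Leaf.
Hypotheses (sing : singular gamma) (Fr0 : (0 < #|F r|)%N).
Variable pi : {set {set V}}.
Hypothesis piP : finset.partition pi [set: V].
Hypothesis treeP : hypertree (hypergraph_of pi).
Hypothesis leafP :
  (\sum_(e <- hypergraph_of pi) (e : {mset 'I_s}%mset) r <= 1)%N.

(** The variables are named by the parts of [pi]; the graphs of [B] are read with
equal variables at vertices in the same part. *)
Definition block_weight B (x : {set V} -> TR) : R :=
  \prod_(i in B) W i (fun a => x (finset.pblock pi (vtx i a))).

Lemma bm_block_weight B : bounded_measurable (block_weight B).
Proof.
apply: bm_prod => i _.
exact: (bm_comp (fun a : F i => finset.pblock pi (vtx i a)) (bW i)).
Qed.

(** At most one vertex of the leaf [F r] lies in a part with other elements; any
vertex does when there is none. *)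
Lemma leaf_attachment : exists a0 : F r, forall a, a != a0 ->
  finset.pblock pi (vtx r a) = [set vtx r a].
Proof.
have single a : ~~ (2 <= #|finset.pblock pi (vtx r a)|)%N ->
    finset.pblock pi (vtx r a) = [set vtx r a].
  rewrite -ltnNge ltnS => le1; apply/eqP.
  rewrite eq_sym eqEcard finset.sub1set cards1 le1 andbT.
  exact: (pblockP piP _).1.
case: (pickP (fun a : F r => 2 <= #|finset.pblock pi (vtx r a)|)%N) => [a0 a02|none].
  exists a0 => a aa0; apply: single; apply: contra aa0 => a2.
  have := leaf_unique piP leafP (erefl : tag (vtx r a) = r)
    (erefl : tag (vtx r a0) = r) a2 a02.
  by move/vtx_inj => ->.
have /card_gt0P[a0 _] := Fr0.
by exists a0 => a _; apply: single; rewrite none.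
Qed.

Local Notation relabelled_density sigma B := (hom_density
  (Defs.contract (block_trace B (relabel_partition sigma pi))) gamma).

Lemma hom_density_relabel sigma B :
  relabelled_density sigma B =
  mean (fun x : {set V} -> TR =>
    \prod_(i in B) W i (fun a => x (finset.pblock pi (relabel sigma (vtx i a))))).
Proof.
apply: (@hom_density_block B _ (relabel_partitionP sigma piP) _
  (fun v => finset.pblock pi (relabel sigma v))); first by rewrite hypergraph_relabel.
move=> v w; rewrite !pblock_relabel //; split=> [-> //|/finset.setP E].
have := E v; rewrite !inE (pblockP piP _).1 => /esym vw.
exact: (same_pblock (partition_trivIset piP)).
Qed.

Lemma hom_density_relabel_out sigma B : r \notin B ->
  relabelled_density sigma B = mean (block_weight B).
Proof.
move=> rB; rewrite hom_density_relabel; apply: eq_mean => x; apply: eq_bigr => i iB.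
congr (weight _ _); apply/funext => a; rewrite relabel_out //.
by apply: contraNneq rB => <-.
Qed.

(** In the contracted graph, [F r] hangs from the rest by a single vertex, which
[sigma] moves around: the other vertices of [F r] are integrated out and leave
a density rooted at the inverse image of [a0] under [sigma].  Summing over
[sigma] produces the constant of [singular_sum_rooted], and [F r] splits off as
a factor, whether or not another graph of [B] shares the part of [a0]. *)
Lemma sum_hom_density_relabel B : r \in B ->
  \sum_sigma relabelled_density sigma B =
  #|{perm F r}|%:R * mean (W r) * mean (block_weight (B :\ r)).
Proof.
move=> rB; have [a0 single] := leaf_attachment.
pose p0 := finset.pblock pi (vtx r a0).
have bB := bm_block_weight (B :\ r).
have rootE sigma : relabelled_density sigma B =
    mean (fun x => block_weight (B :\ r) x *
                   rooted (W r) ((sigma^-1)%g a0) (x p0)).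
  rewrite hom_density_relabel.
  pose y a := finset.pblock pi (vtx r (sigma a)).
  rewrite (eq_mean (psi := fun x : {set V} -> TR =>
    block_weight (B :\ r) x * W r (x \o y))); last first.
    move=> x; rewrite (big_setD1 r rB) /= [LHS]mulrC.
    have -> : (fun a => x (finset.pblock pi (relabel sigma (vtx r a)))) = x \o y.
      by apply/funext => a; rewrite relabel_in.
    apply: (congr1 (fun z => z * _)); rewrite /block_weight.
    apply: eq_bigr => i /setD1P[ir iB]; apply: congr1; apply/funext => a.
    by rewrite relabel_out.
  have y_inj : injective y.
    move=> a b yab; apply: (@perm_inj _ sigma); apply: vtx_inj.
    have ma := pblockP piP (vtx r (sigma a)).
    have mb := pblockP piP (vtx r (sigma b)).
    apply: (hypertree_tag_inj treeP mb.2 _ mb.1) => //.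
    by have := ma.1; rewrite -/(y a) yab.
  have y_ext (x x' : {set V} -> TR) :
      (forall P, (forall a, a != (sigma^-1)%g a0 -> y a != P) -> x P = x' P) ->
      block_weight (B :\ r) x = block_weight (B :\ r) x'.
    move=> xx'; rewrite /block_weight; apply: eq_bigr => i /setD1P[ir iB].
    apply: congr1; apply/funext => b; apply: xx' => a aa0.
    have sa : sigma a != a0 by apply: contra aa0 => /eqP <-; rewrite permK.
    apply/eqP => E; have := (pblockP piP (vtx i b)).1; rewrite -E /y single // inE.
    by move=> /eqP/(congr1 tag)/= ri; rewrite ri eqxx in ir.
  have := @mean_pendant R _ (F r) (W r) (block_weight (B :\ r)) y ((sigma^-1)%g a0)
    (bW r) bB y_inj y_ext.
  have -> : y ((sigma^-1)%g a0) = p0 by rewrite /y permKV.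
  by [].
have k0 : #|F r|%:R != 0 :> R by rewrite pnatr_eq0 -lt0n.
apply: (mulfI k0).
have bR (b : F r) : bounded_measurable (fun x : {set V} -> TR =>
    block_weight (B :\ r) x * rooted (W r) b (x p0)).
  by apply: bmM => //; exact: bm_rooted.
rewrite (eq_bigr _ (fun sigma _ => rootE sigma)) -mean_sum //.
have bSum := bm_sum (fun (sigma : {perm F r}) (_ : true) => bR ((sigma^-1)%g a0)).
rewrite -(meanZ _ bSum).
transitivity (mean (fun x => #|{perm F r}|%:R *
  (block_weight (B :\ r) x * \sum_a rooted (W r) a (x p0)))).
  apply: eq_mean => x; rewrite -mulr_sumr mulrCA [RHS]mulrCA; congr (_ * _).
  rewrite (reindex_inj invg_inj) /=.
  under eq_bigr do rewrite invgK.
  exact: (sum_perm_uniform (fun a => rooted (W r) a (x p0))).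
rewrite meanZ; last by apply: bmM => //; apply: bm_sum => a _; exact: bm_rooted.
by rewrite singular_sum_rooted //; ring.
Qed.

(** Once [F r] has split off, the factor it leaves is the same for every [theta],
and the rest only sees the blocks with [r] removed: this is the Moebius sum. *)
Lemma sum_kappa_pi_relabel : (2 <= s)%N ->
  \sum_sigma kappa_pi (relabel_partition sigma pi) gamma = 0.
Proof.
move=> s2; rewrite exchange_big /=.
transitivity (#|{perm F r}|%:R * mean (W r) *
  \sum_(theta : {set {set 'I_s}} | finset.partition theta [set: 'I_s])
     mobius_coef R theta * \prod_(B in theta) mean (block_weight (B :\ r))).
  rewrite mulr_sumr; apply: eq_bigr => theta thP.
  have rcov : r \in finset.cover theta by rewrite (cover_partition thP) inE.
  have rQ : r \in finset.pblock theta r by rewrite mem_pblock.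
  have Qt := pblock_mem rcov.
  rewrite -mulr_sumr mulrCA; congr (_ * _).
  have out B : B \in theta -> B != finset.pblock theta r -> r \notin B.
    move=> Bt; apply: contra => rB.
    by rewrite (def_pblock (partition_trivIset thP) Bt rB).
  rewrite (big_setD1 _ Qt) /= mulrA -sum_hom_density_relabel // mulr_suml.
  apply: eq_bigr => sigma _; rewrite (big_setD1 _ Qt) /=; congr (_ * _).
  apply: eq_bigr => B /setD1P[BQ Bt]; rewrite hom_density_relabel_out ?out //.
  congr (mean (block_weight _)); apply/esym/finset.setDidPl.
  by rewrite disjoint_sym disjoints1 out.
rewrite (moebius_sum_eq0 r (psi := fun B => mean (block_weight B)));
  rewrite ?mulr0 ?card_ord //.
rewrite /block_weight (eq_mean (psi := fun=> 1)) ?mean_cst // => x.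
by rewrite big_set0.
Qed.
End Leaf.
End Relabel.

End Core.

Theorem theorem15 (R : realType) (gamma : graphon R) (Hsing : singular gamma)
    (s : nat) (Hs : (2 <= s)%N) (F : 'I_s -> sgraph)
    (HF : forall r : 'I_s, (0 < #|F r|)%N) :
  kappa F gamma = 0.
Proof.
apply: fsbig1 => H HT; have [r leafr] := hypertree_leaf Hs HT.
have n0 : #|{perm F r}|%:R != 0 :> R.
  by rewrite pnatr_eq0 -lt0n; apply/card_gt0P; exists 1%g.
apply: (mulfI n0); rewrite mulr0 mulr_natl -sumr_const.
rewrite (eq_bigr _ (fun sigma _ =>
  sum_relabel H sigma (fun pi => kappa_pi pi gamma))).
rewrite exchange_big /= big1 // => pi /andP[piP /eqP piH].
by apply: sum_kappa_pi_relabel => //; rewrite piH.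
Qed.
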